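(* Let $\Gamma$ be an arbitrary group with identity $e$ and let $A=\bigoplus_{g\in\Gamma}A_g$ be a faithfully $\Gamma$-graded quasi-Hopf algebra over a field $\Bbbk$. Then the following are equivalent: (i) There is a morphism of quasi-Hopf algebras $\tau\colon A\to A_e$ with $\tau|_{A_e}=\mathrm{id}$. (ii) There is an augmented quasi-Hopf ideal $L\subseteq A$ with $L\cap A_e=0$. (iii) There are group-like units $u_g\in A_g$, for $g\in\Gamma$, such that $u_gu_h=u_{gh}$ for all $g,h\in\Gamma$ and $u_gb=bu_g$ for every $g\in\Gamma$ and $b\in A_e$. In that case the relations $L=\ker(\tau)$ and $\tau(u_g)=1$ (for all $g\in\Gamma$) determine the three data $\tau$, $L$, $(u_g)_{g\in\Gamma}$ from one another, and $b\otimes\zeta_g\mapsto bu_g$ is an isomorphism of $\Gamma$-graded quasi-Hopf algebras from $A_e\otimes\Bbbk[\Gamma]$ onto $A$.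
   Context: Conventions. $\Bbbk$ is a field; vector spaces, algebras and tensor products are over $\Bbbk$; algebras are unital and algebra (anti-)morphisms preserve units. Summation is suppressed: $\Delta(x)=x'\otimes x''$, $\Phi=\Phi^{(1)}\otimes\Phi^{(2)}\otimes\Phi^{(3)}$, $\Phi^{-1}=\Phi^{(-1)}\otimes\Phi^{(-2)}\otimes\Phi^{(-3)}$. Quasi-Hopf algebras. A quasi-Hopf algebra is an algebra $A$ with algebra morphisms $\Delta\colon A\to A\otimes A$, $\varepsilon\colon A\to\Bbbk$, an invertible $\Phi\in A^{\otimes 3}$, an algebra anti-morphism $S\colon A\to A$ (not assumed bijective) and elements $\alpha,\beta\in A$ such that for all $x\in A$: $(1\otimes\Phi)(\mathrm{id}\otimes\Delta\otimes\mathrm{id})(\Phi)(\Phi\otimes1)=(\mathrm{id}\otimes\mathrm{id}\otimes\Delta)(\Phi)(\Delta\otimes\mathrm{id}\otimes\mathrm{id})(\Phi)$; $\Phi(\Delta\otimes\mathrm{id})(\Delta(x))=(\mathrm{id}\otimes\Delta)(\Delta(x))\Phi$; $(\mathrm{id}\otimes\varepsilon\otimes\mathrm{id})(\Phi)=1\otimes1$; $(\mathrm{id}\otimes\varepsilon)\Delta(x)=x=(\varepsilon\otimes\mathrm{id})\Delta(x)$; $S(x')\alpha x''=\varepsilon(x)\alpha$; $x'\beta S(x'')=\varepsilon(x)\beta$; $\Phi^{(1)}\beta S(\Phi^{(2)})\alpha\Phi^{(3)}=1=S(\Phi^{(-1)})\alpha\Phi^{(-2)}\beta S(\Phi^{(-3)})$.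 Throughout, $(\alpha,\beta)$ is normalized by $\varepsilon(\alpha)=\varepsilon(\beta)=1$. A morphism of quasi-Hopf algebras is an algebra morphism commuting with $\Delta,\varepsilon,S$ and carrying $\Phi,\alpha,\beta$ to $\Phi,\alpha,\beta$. A quasi-Hopf ideal of $A$ is a two-sided ideal $L$ with $\Delta(L)\subseteq L\otimes A+A\otimes L$, $\varepsilon(L)=0$, $S(L)\subseteq L$. An element $x$ is group-like if $\Delta(x)=x\otimes x$ and $\varepsilon(x)=1$. Gradings. A $\Gamma$-graded quasi-Hopf algebra is a quasi-Hopf algebra with a vector space decomposition $A=\bigoplus_{g\in\Gamma}A_g$ such that $A_gA_h\subseteq A_{gh}$, $\Delta(A_g)\subseteq A_g\otimes A_g$, $S(A_g)\subseteq A_{g^{-1}}$, $\Phi\in A_e^{\otimes3}$, $\alpha,\beta\in A_e$; then $A_e$ is a quasi-Hopf algebra with the restricted structure. It is faithfully graded if $A_g\neq0$ for all $g$. A graded morphism $f$ satisfies $f(A_g)\subseteq A'_g$ for all $g$. The group algebra $\Bbbk[\Gamma]$ has basis $\{\zeta_g\}_{g\in\Gamma}$ with $\zeta_g\zeta_h=\zeta_{gh}$, and is a Hopf algebra with $\zeta_g$ group-like and $S(\zeta_g)=\zeta_{g^{-1}}$; its augmentation ideal $\mathfrak{a}_\Gamma$ is the span of the $\zeta_g-\zeta_e$. The grading map of a faithfully graded $A$ is $\pi\colon A\to\Bbbk[\Gamma]$, $\pi(x_g)=\varepsilon(x_g)\zeta_g$ for $x_g\in A_g$. A quasi-Hopf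 ideal $L\subseteq A$ is augmented if $\pi(L)=\mathfrak{a}_\Gamma$. The quasi-Hopf algebra $A_e\otimes\Bbbk[\Gamma]$ has componentwise product, $\Delta(x\otimes\zeta_g)=(x'\otimes\zeta_g)\otimes(x''\otimes\zeta_g)$, $\varepsilon(x\otimes\zeta_g)=\varepsilon(x)$, $S(x\otimes\zeta_g)=S(x)\otimes\zeta_{g^{-1}}$, with reassociator and distinguished elements the images of $\Phi,\alpha,\beta$ under $x\mapsto x\otimes\zeta_e$; it is $\Gamma$-graded with components $A_e\otimes\Bbbk\zeta_g$. *)

(* Defs.v *)
From HB Require Import structures.
From mathcomp Require Import all_boot all_order all_algebra finmap.
From mathcomp Require Import boolp classical_sets.
From mathcomp Require Import monalg.

Set Implicit Arguments.
Unset Strict Implicit.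
Unset Printing Implicit Defensive.

Import GRing.Theory.
Local Open Scope ring_scope.
Local Open Scope quotient_scope.

Reserved Notation "u ⊗ v" (at level 38, right associativity).

Section TensorDef.
Variables (k : fieldType) (U V : lmodType k).

(* The presentation of U ⊗ V: finite formal sums of pairs, modulo the least
   congruence making pairs biadditive and balanced. *)
Inductive tens_rel : seq (U * V) -> seq (U * V) -> Prop :=
| TensRefl s : tens_rel s s
| TensSym s t : tens_rel s t -> tens_rel t s
| TensTrans s t r : tens_rel s t -> tens_rel t r -> tens_rel s r
| TensCat s s' t t' :
    tens_rel s s' -> tens_rel t t' -> tens_rel (s ++ t) (s' ++ t')
| TensCatC s t : tens_rel (s ++ t) (t ++ s)
| Tens0l v : tens_rel [:: (0, v)] [::]
| TensDl u u' v : tens_rel [:: (u + u', v)] [:: (u, v); (u', v)]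
| TensDr u v v' : tens_rel [:: (u, v + v')] [:: (u, v); (u, v')]
| TensZ a u v : tens_rel [:: (a *: u, v)] [:: (u, a *: v)].

Definition tens_relb : rel (seq (U * V)) := fun s t => `[< tens_rel s t >].

Lemma tens_relb_refl : reflexive tens_relb.
Proof. by move=> s; apply/asboolP/TensRefl. Qed.

Lemma tens_relb_sym : symmetric tens_relb.
Proof. by move=> s t; apply/asboolP/asboolP => /TensSym. Qed.

Lemma tens_relb_trans : transitive tens_relb.
Proof. by move=> t s r /asboolP st /asboolP tr; apply/asboolP/(TensTrans st). Qed.

Canonical tens_equiv : equiv_rel (seq (U * V)) :=
  EquivRel tens_relb tens_relb_refl tens_relb_sym tens_relb_trans.

Definition tensor : Type := {eq_quot tens_equiv}.

HB.instance Definition _ := Choice.on tensor.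
HB.instance Definition _ := EqQuotient.on tensor.

Definition pure (u : U) (v : V) : tensor := \pi_tensor [:: (u, v)].

(* [tlift f (u ⊗ v) = f u v] when [f] is bilinear, see [tliftE]. *)
Definition tlift (W : zmodType) (f : U -> V -> W) (t : tensor) : W :=
  \sum_(p <- repr t) f p.1 p.2.

Lemma tens_eqP s t : \pi_tensor s = \pi_tensor t <-> tens_rel s t.
Proof.
split=> [/eqP|st]; last by apply/eqP; rewrite eqmodE; apply/asboolP.
by rewrite eqmodE => /asboolP.
Qed.

End TensorDef.

Arguments tlift {k U V W} f t.
Arguments pure {k U V} u v.

Notation "U ⊗ V" := (tensor U V) : type_scope.
Notation "u ⊗ v" := (pure u v) : ring_scope.

Section TensorMod.
Variables (k : fieldType) (U V : lmodType k).
Local Notation T := (U ⊗ V)%type.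
Implicit Types (s t : seq (U * V)) (x y z : T).

Definition tscale_seq (a : k) s := [seq (a *: p.1, p.2) | p <- s].

Lemma tens_relZ a s t : tens_rel s t -> tens_rel (tscale_seq a s) (tscale_seq a t).
Proof.
move=> st; elim: st => {s t}.
- by move=> s; exact: TensRefl.
- by move=> s t _; exact: TensSym.
- by move=> s t r _ IH1 _; exact: TensTrans IH1.
- by move=> s s' t t' _ IH1 _ IH2; rewrite /tscale_seq !map_cat; exact: TensCat.
- by move=> s t; rewrite /tscale_seq !map_cat; exact: TensCatC.
- by move=> v; rewrite /= scaler0; exact: Tens0l.
- by move=> u u' v; rewrite /= scalerDr; exact: TensDl.
- by move=> u v v'; exact: TensDr.
- by move=> b u v; rewrite /= scalerA mulrC -scalerA; exact: TensZ.
Qed.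

Definition tadd x y : T := \pi_T (repr x ++ repr y).
Definition tscale (a : k) x : T := \pi_T (tscale_seq a (repr x)).
Definition tzero : T := \pi_T [::].
Definition topp x : T := tscale (-1) x.

Lemma repr_tens_rel s : tens_rel (repr (\pi_T s)) s.
Proof. by apply/tens_eqP; rewrite reprK. Qed.

Lemma tadd_pi s t : tadd (\pi_T s) (\pi_T t) = \pi_T (s ++ t).
Proof. by apply/tens_eqP/TensCat; exact: repr_tens_rel. Qed.

Lemma tscale_pi a s : tscale a (\pi_T s) = \pi_T (tscale_seq a s).
Proof. by apply/tens_eqP/tens_relZ/repr_tens_rel. Qed.

Lemma taddA : associative tadd.
Proof.
elim/quotW=> x; elim/quotW=> y; elim/quotW=> z.
by rewrite (tadd_pi y z) (tadd_pi x y) (tadd_pi x) (tadd_pi _ z) catA.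
Qed.

Lemma taddC : commutative tadd.
Proof.
by elim/quotW=> x; elim/quotW=> y; rewrite !tadd_pi; apply/tens_eqP/TensCatC.
Qed.

Lemma tadd0 : left_id tzero tadd.
Proof. by elim/quotW=> x; rewrite tadd_pi. Qed.

Lemma tscaleA a b x : tscale a (tscale b x) = tscale (a * b) x.
Proof.
elim/quotW: x => x; rewrite (tscale_pi b) (tscale_pi a) tscale_pi.
congr (\pi _); rewrite /tscale_seq -map_comp.
by apply: eq_map => p /=; rewrite scalerA.
Qed.

Lemma tscale1 : left_id 1 tscale.
Proof.
elim/quotW=> x; rewrite tscale_pi; congr (\pi _).
by rewrite /tscale_seq -[RHS]map_id; apply: eq_map => -[u v] /=; rewrite scale1r.
Qed.

Lemma tscaleDr : right_distributive tscale tadd.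
Proof.
move=> a; elim/quotW=> x; elim/quotW=> y.
rewrite (tadd_pi x) !(tscale_pi a) tadd_pi.
by rewrite /tscale_seq map_cat.
Qed.

Lemma tens_rel_swap p q s t : tens_rel ([:: p; q] ++ s ++ t) (p :: s ++ q :: t).
Proof.
rewrite -[_ ++ _]/([:: p] ++ [:: q] ++ s ++ t) -[p :: _]cat1s -[q :: t]cat1s.
apply: TensCat (TensRefl _) _; rewrite !catA.
exact: TensCat (TensCatC _ _) (TensRefl _).
Qed.

Lemma tscaleDl x : {morph tscale^~ x : a b / a + b >-> tadd a b}.
Proof.
elim/quotW: x => x a b; rewrite !tscale_pi tadd_pi; apply/tens_eqP.
elim: x => [|p s IH] /=; first exact: TensRefl.
rewrite scalerDl -cat1s; apply: TensTrans (TensCat (TensDl _ _ _) IH) _.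
exact: tens_rel_swap.
Qed.

Lemma tscale0 x : tscale 0 x = tzero.
Proof.
elim/quotW: x => x; rewrite tscale_pi; apply/tens_eqP.
elim: x => [|p s IH] /=; first exact: TensRefl.
rewrite scale0r -cat1s.
by apply: (TensTrans (TensCat (Tens0l _ _) IH)); exact: TensRefl.
Qed.

Lemma taddN : left_inverse tzero topp tadd.
Proof.
move=> x; rewrite -[X in tadd _ X]tscale1 /topp -tscaleDl addNr.
exact: tscale0.
Qed.

HB.instance Definition _ := GRing.isZmodule.Build T taddA taddC tadd0 taddN.
HB.instance Definition _ :=
  GRing.Zmodule_isLmodule.Build k T tscaleA tscale1 tscaleDr tscaleDl.

Lemma pi_cat s t : \pi_T (s ++ t) = \pi_T s + \pi_T t.
Proof. by rewrite -[RHS]/(tadd _ _) tadd_pi. Qed.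

Lemma pi_sum s : \pi_T s = \sum_(p <- s) p.1 ⊗ p.2.
Proof.
elim: s => [|[u v] s IH]; first by rewrite big_nil.
by rewrite big_cons -IH -cat1s pi_cat.
Qed.

Lemma tensorE x : x = \sum_(p <- repr x) p.1 ⊗ p.2.
Proof. by rewrite -pi_sum reprK. Qed.

Lemma pureDl u u' v : (u + u') ⊗ v = u ⊗ v + u' ⊗ v :> T.
Proof. by rewrite -pi_cat; apply/tens_eqP/TensDl. Qed.

Lemma pureDr u v v' : u ⊗ (v + v') = u ⊗ v + u ⊗ v' :> T.
Proof. by rewrite -pi_cat; apply/tens_eqP/TensDr. Qed.

Lemma pureZl a u v : (a *: u) ⊗ v = a *: (u ⊗ v) :> T.
Proof. by rewrite -[RHS]/(tscale _ _) tscale_pi. Qed.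

Lemma pureZr a u v : u ⊗ (a *: v) = a *: (u ⊗ v) :> T.
Proof. by rewrite -pureZl; apply/tens_eqP/TensSym/TensZ. Qed.

End TensorMod.

Definition bilin (k : fieldType) (U V W : lmodType k) (f : U -> V -> W) : Prop :=
  (forall v, linear (f^~ v)) /\ (forall u, linear (f u)).

Section LinearFun.
Variables (k : fieldType) (U : lmodType k).

Lemma linear_fD (W : lmodType k) (f : U -> W) : linear f -> {morph f : x y / x + y}.
Proof. by move=> lf x y; have := lf 1 x y; rewrite !scale1r. Qed.

Lemma linear_f0 (W : lmodType k) (f : U -> W) : linear f -> f 0 = 0.
Proof. by move=> lf; apply: (addrI (f 0)); rewrite -(linear_fD lf) !addr0. Qed.

Lemma linear_fZ (W : lmodType k) (f : U -> W) : linear f -> forall a, {morph f : x / a *: x}.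
Proof. by move=> lf a x; have := lf a x 0; rewrite (linear_f0 lf) !addr0. Qed.

End LinearFun.

Section Tlift.
Variables (k : fieldType) (U V W : lmodType k) (f : U -> V -> W).
Hypothesis bf : bilin f.

Let f0l v : f 0 v = 0.
Proof. by have := bf.1 v 0 0 0; rewrite scale0r add0r => ->; rewrite scale0r add0r; have := bf.1 v (-1) 0 0; rewrite scaler0 addr0 scaleN1r addNr. Qed.

Let fDl u u' v : f (u + u') v = f u v + f u' v.
Proof. by have := bf.1 v 1 u u'; rewrite !scale1r. Qed.

Let fDr u v v' : f u (v + v') = f u v + f u v'.
Proof. by have := bf.2 u 1 v v'; rewrite !scale1r. Qed.

Let fZl a u v : f (a *: u) v = a *: f u v.
Proof. by have := bf.1 v a u 0; rewrite !addr0 f0l addr0. Qed.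

Let f0r u : f u 0 = 0.
Proof. by apply: (addrI (f u 0)); rewrite -fDr !addr0. Qed.

Let fZr a u v : f u (a *: v) = a *: f u v.
Proof. by have := bf.2 u a v 0; rewrite !addr0 f0r addr0. Qed.

Lemma tlift_rel s t : tens_rel s t ->
  \sum_(p <- s) f p.1 p.2 = \sum_(p <- t) f p.1 p.2.
Proof.
move=> st; elim: st => {s t}; rewrite //=.
- by move=> s t r _ -> _ ->.
- by move=> s s' t t' _ E1 _ E2; rewrite !big_cat /= E1 E2.
- by move=> s t; rewrite !big_cat /= addrC.
- by move=> v; rewrite big_seq1 big_nil f0l.
- by move=> u u' v; rewrite big_seq1 big_cons big_seq1 fDl.
- by move=> u v v'; rewrite big_seq1 big_cons big_seq1 fDr.
- by move=> a u v; rewrite !big_seq1 fZl fZr.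
Qed.

Lemma tlift_pi s : tlift f (\pi_(U ⊗ V)%type s) = \sum_(p <- s) f p.1 p.2.
Proof. exact/tlift_rel/repr_tens_rel. Qed.

Lemma tliftE u v : tlift f (u ⊗ v) = f u v.
Proof. by rewrite tlift_pi big_seq1. Qed.

Lemma tlift_is_linear : linear (tlift f).
Proof.
move=> a; elim/quotW=> x; elim/quotW=> y.
rewrite -[a *: _]/(tscale _ _) tscale_pi -pi_cat !tlift_pi big_cat /=.
congr (_ + _); rewrite big_map scaler_sumr.
by apply: eq_bigr => p _; rewrite /= fZl.
Qed.

End Tlift.

Section TensInd.
Variables (k : fieldType) (U V : lmodType k).

Lemma tens_ind (P : (U ⊗ V)%type -> Prop) :
  P 0 -> (forall x y, P x -> P y -> P (x + y)) -> (forall u v, P (u ⊗ v)) ->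
  forall x, P x.
Proof.
by move=> P0 PD Pp x; rewrite (tensorE x); elim/big_ind: _ => // p _; exact: Pp.
Qed.

Lemma pure0l v : (0 : U) ⊗ v = 0 :> (U ⊗ V)%type.
Proof. by rewrite -(scale0r 0) pureZl scale0r. Qed.

Lemma pure0r u : u ⊗ (0 : V) = 0 :> (U ⊗ V)%type.
Proof. by rewrite -(scale0r 0) pureZr scale0r. Qed.

Lemma pure_bilin : bilin (@pure k U V).
Proof.
split=> w a x y; first by rewrite pureDl pureZl.
by rewrite pureDr pureZr.
Qed.

Lemma tens_ext (W : lmodType k) (f g : (U ⊗ V)%type -> W) :
  linear f -> linear g -> (forall u v, f (u ⊗ v) = g (u ⊗ v)) -> f =1 g.
Proof.
move=> lf lg fg; elim/tens_ind => [||//].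
  by rewrite !linear_f0.
by move=> x y fx fy; rewrite (linear_fD lf) (linear_fD lg) fx fy.
Qed.

End TensInd.

Section Tmap.
Variable k : fieldType.

Definition tmap (U U' V V' : lmodType k) (f : U -> U') (g : V -> V') :
  (U ⊗ V)%type -> (U' ⊗ V')%type := tlift (fun u v => f u ⊗ g v).

Definition tassoc (U V W : lmodType k) :
  ((U ⊗ V) ⊗ W)%type -> (U ⊗ (V ⊗ W))%type :=
  tlift (fun t w => tlift (fun u v => u ⊗ (v ⊗ w)) t).

Lemma bilin_comp (U U' V V' W : lmodType k) (f : U -> U') (g : V -> V')
  (h : U' -> V' -> W) : linear f -> linear g -> bilin h ->
  bilin (fun u v => h (f u) (g v)).
Proof.
move=> lf lg bh; split=> w a x y; first by rewrite lf bh.1.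
by rewrite lg bh.2.
Qed.

Lemma linear_comp (U V W : lmodType k) (f : U -> V) (g : V -> W) :
  linear f -> linear g -> linear (fun u => g (f u)).
Proof. by move=> lf lg a x y; rewrite lf lg. Qed.

Lemma linear_id (U : lmodType k) : linear (@id U).
Proof. by []. Qed.

Section TmapTheory.
Variables (U U' V V' : lmodType k) (f : U -> U') (g : V -> V').
Hypotheses (lf : linear f) (lg : linear g).

Lemma tmap_bilin : bilin (fun u v => f u ⊗ g v).
Proof. exact: bilin_comp (pure_bilin _ _). Qed.

Lemma tmapE u v : tmap f g (u ⊗ v) = f u ⊗ g v.
Proof. exact: (tliftE tmap_bilin). Qed.

Lemma tmap_linear : linear (tmap f g).
Proof. exact: tlift_is_linear tmap_bilin. Qed.

End TmapTheory.

Section TassocTheory.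
Variables U V W : lmodType k.

Lemma tassoc_bilin1 (w : W) : bilin (fun (u : U) (v : V) => u ⊗ (v ⊗ w)).
Proof.
by split=> x a y z; rewrite /= !(pureDl, pureZl) ?(pureDr, pureZr).
Qed.

Lemma tassoc_bilin :
  bilin (fun (t : (U ⊗ V)%type) (w : W) => tlift (fun u v => u ⊗ (v ⊗ w)) t).
Proof.
split=> [w|t]; first exact: tlift_is_linear (tassoc_bilin1 w).
move=> a w w'; elim/tens_ind: t => [|x y IHx IHy|u v].
- by rewrite !(linear_f0 (tlift_is_linear (tassoc_bilin1 _))) scaler0 addr0.
- rewrite !(linear_fD (tlift_is_linear (tassoc_bilin1 _))) IHx IHy.
  by rewrite scalerDr addrACA.
- by rewrite !(tliftE (tassoc_bilin1 _)) !(pureDr, pureZr).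
Qed.

Lemma tassocE (u : U) (v : V) (w : W) : tassoc ((u ⊗ v) ⊗ w) = u ⊗ (v ⊗ w).
Proof. by rewrite /tassoc (tliftE tassoc_bilin) (tliftE (tassoc_bilin1 w)). Qed.

Lemma tassoc_linear : linear (@tassoc U V W).
Proof. exact: tlift_is_linear tassoc_bilin. Qed.

End TassocTheory.
End Tmap.

Section LinearForm.
Variables (k : fieldType) (V : lmodType k) (v : V).

Lemma exists_linear_form : v != 0 -> exists2 f : V -> k^o, linear f & f v = 1.
Proof.
move=> v0.
pose P (W : set V) := (forall a x y, W x -> W y -> W (a *: x + y)) /\ ~ W v.
have [|W [[WL Wv] Wmax]] := @Zorn_bigcup V P.
  move=> F FP tot; split=> [a x y [X FX Xx] [Y FY Yy]|[X FX]]; last exact: (FP _ FX).2.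
  have [XY|YX] := tot _ _ FX FY.
    by exists Y => //; apply: (FP _ FY).1 => //; apply: XY.
  by exists X => //; apply: (FP _ FX).1 => //; apply: YX.
have W0 : W 0.
  apply: contrapT => nW0; apply: (Wmax (W `|` [set 0])%classic).
    split; first by move=> x Wx; left.
    by move=> sub; apply: nW0; apply: sub; right.
  split=> [a x y [Wx|->] [Wy|->]|[//|v0']].
  - by left; exact: WL.
  - rewrite addr0; left.
    have E : (a - 1) *: x + x = a *: x by rewrite scalerBl scale1r subrK.
    by rewrite -E; exact: WL.
  - by rewrite scaler0 add0r; left.
  - by rewrite scaler0 addr0; right.
  - by rewrite v0' eqxx in v0.
have WZ a x : W x -> W (a *: x) by move=> Wx; rewrite -[_ *: _]addr0; exact: WL.
have WD x y : W x -> W y -> W (x + y).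
  by move=> Wx Wy; rewrite -[x]scale1r; exact: WL.
have ex x : exists c : k, W (x - c *: v).
  have [Wx|nWx] := pselect (W x); first by exists 0; rewrite scale0r subr0.
  pose W' := [set y | exists a w, W w /\ y = a *: x + w]%classic.
  have : ~ P W'.
    apply: Wmax; split; first by move=> y Wy; exists 0, y; rewrite scale0r add0r.
    by move=> sub; apply: nWx; apply: sub; exists 1, 0; rewrite scale1r addr0.
  have W'L a y z : W' y -> W' z -> W' (a *: y + z).
    move=> [b [w [Ww ->]]] [c [w' [Ww' ->]]].
    exists (a * b + c), (a *: w + w'); split; first exact: WL.
    by rewrite scalerDr scalerA addrACA -scalerDl.
  move=> nP; have [a [w [Ww E]]] : W' v.
    by apply: contrapT => nW'v; apply: nP; split.
  have a0 : a != 0.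
    by apply/eqP => a0; apply: Wv; rewrite E a0 scale0r add0r.
  exists a^-1; rewrite E scalerDr scalerA mulVf // scale1r opprD addrA subrr add0r.
  by rewrite -scaleN1r; exact/WZ/WZ.
have uniq x c c' : W (x - c *: v) -> W (x - c' *: v) -> c = c'.
  move=> Wc Wc'; apply: contrapT => /eqP ne; apply: Wv.
  have d0 : c' - c != 0 by rewrite subr_eq0 eq_sym.
  have -> : v = (c' - c)^-1 *: ((x - c *: v) + (-1) *: (x - c' *: v)).
    rewrite scaleN1r opprB addrACA addrC addrA subrK -scaleNr -scalerDl.
    by rewrite [- c + _]addrC scalerA mulVf // scale1r.
  by apply: (WZ); apply: WD => //; exact: WZ.
pose f x := projT1 (cid (ex x)).
have fP x : W (x - f x *: v) by exact: projT2 (cid (ex x)).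
exists f.
  move=> a x y; apply: uniq (fP _) _.
  have -> : a *: x + y - (a *: (f x : k^o) + f y) *: v
            = a *: (x - f x *: v) + (y - f y *: v).
    by rewrite scalerDl opprD scalerBr scalerA addrACA.
  exact: WL.
by apply: uniq (fP _) _; rewrite scale1r subrr.
Qed.

End LinearForm.

Lemma pure_neq0 (k : fieldType) (U V : lmodType k) (u : U) (v : V) :
  u != 0 -> v != 0 -> u ⊗ v != 0.
Proof.
move=> /exists_linear_form[f lf fu] /exists_linear_form[g lg gv].
have bfg : bilin (fun u v => f u * g v : k^o).
  split=> w a x y /=; first by rewrite lf mulrDl -scalerAl.
  by rewrite lg mulrDr -scalerAr.
apply/eqP => E; have := tliftE bfg u v.
rewrite E (linear_f0 (tlift_is_linear bfg)) fu gv mulr1 => /esym/eqP.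
by rewrite oner_eq0.
Qed.

Section TensorAlgebra.
Variables (k : fieldType) (A B : algType k).
Local Notation T := (A ⊗ B)%type.
Implicit Types x y z : T.

Definition tmul (x y : T) : T :=
  tlift (fun a b => tlift (fun a' b' => (a * a') ⊗ (b * b')) y) x.

Definition tone : T := 1 ⊗ 1.

Lemma tmul_bilin1 (a : A) (b : B) : bilin (fun a' b' => (a * a') ⊗ (b * b')).
Proof.
split=> c l u v /=.
  by rewrite mulrDr -scalerAr pureDl pureZl.
by rewrite mulrDr -scalerAr pureDr pureZr.
Qed.

Lemma tmul_bilin2 y :
  bilin (fun a b => tlift (fun a' b' => (a * a') ⊗ (b * b')) y).
Proof.
have L a b := tlift_is_linear (tmul_bilin1 a b).
split=> c l u v /=.
  elim/tens_ind: y => [|y z Hy Hz|a b].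
  - by rewrite !(linear_f0 (L _ _)) scaler0 addr0.
  - by rewrite !(linear_fD (L _ _)) Hy Hz scalerDr addrACA.
  - by rewrite !(tliftE (tmul_bilin1 _ _)) mulrDl -scalerAl pureDl pureZl.
elim/tens_ind: y => [|y z Hy Hz|a b].
- by rewrite !(linear_f0 (L _ _)) scaler0 addr0.
- by rewrite !(linear_fD (L _ _)) Hy Hz scalerDr addrACA.
- by rewrite !(tliftE (tmul_bilin1 _ _)) mulrDl -scalerAl pureDr pureZr.
Qed.

Lemma tmul_pure a b a' b' : tmul (a ⊗ b) (a' ⊗ b') = (a * a') ⊗ (b * b').
Proof. by rewrite /tmul (tliftE (tmul_bilin2 _)) (tliftE (tmul_bilin1 _ _)). Qed.

Lemma tmul_linearl y : linear (tmul^~ y).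
Proof. exact: tlift_is_linear (tmul_bilin2 y). Qed.

Lemma tmul_linearr x : linear (tmul x).
Proof.
move=> a y z; have L u v := tlift_is_linear (tmul_bilin1 u v).
elim/tens_ind: x => [|x x' Hx Hx'|u v].
- by rewrite !(linear_f0 (tmul_linearl _)) scaler0 addr0.
- rewrite !(linear_fD (tmul_linearl _)) Hx Hx' scalerDr addrACA //.
- by rewrite /tmul !(tliftE (tmul_bilin2 _)) L.
Qed.

Lemma tmulDl : left_distributive tmul +%R.
Proof. by move=> x y z; exact: (linear_fD (tmul_linearl z)). Qed.

Lemma tmulDr : right_distributive tmul +%R.
Proof. by move=> x y z; exact: (linear_fD (tmul_linearr x)). Qed.

Lemma tmul0l x : tmul 0 x = 0.
Proof. exact: (linear_f0 (tmul_linearl x)). Qed.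

Lemma tmul0r x : tmul x 0 = 0.
Proof. exact: (linear_f0 (tmul_linearr x)). Qed.

Lemma tmulA : associative tmul.
Proof.
move=> x y z; elim/tens_ind: x => [|x x' Hx Hx'|a b].
- by rewrite !tmul0l.
- by rewrite !tmulDl Hx Hx'.
elim/tens_ind: y => [|y y' Hy Hy'|c d].
- by rewrite tmul0l !tmul0r tmul0l.
- by rewrite tmulDl !tmulDr tmulDl Hy Hy'.
elim/tens_ind: z => [|z z' Hz Hz'|e f].
- by rewrite !tmul0r.
- by rewrite !tmulDr Hz Hz'.
by rewrite (tmul_pure c d) (tmul_pure a b c) !tmul_pure !mulrA.
Qed.

Lemma tmul1l : left_id tone tmul.
Proof.
move=> x; elim/tens_ind: x => [|x y Hx Hy|a b]; first exact: tmul0r.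
  by rewrite tmulDr Hx Hy.
by rewrite tmul_pure !mul1r.
Qed.

Lemma tmul1r : right_id tone tmul.
Proof.
move=> x; elim/tens_ind: x => [|x y Hx Hy|a b]; first exact: tmul0l.
  by rewrite tmulDl Hx Hy.
by rewrite tmul_pure !mulr1.
Qed.

Lemma tone_neq0 : tone != 0.
Proof. by apply: pure_neq0; exact: oner_neq0. Qed.

HB.instance Definition _ := GRing.Zmodule_isNzRing.Build T
  tmulA tmul1l tmul1r tmulDl tmulDr tone_neq0.

Lemma tscaleAl a x y : a *: (x * y) = a *: x * y.
Proof. by rewrite [LHS](esym (linear_fZ (tmul_linearl y) a x)). Qed.

HB.instance Definition _ := GRing.Lmodule_isLalgebra.Build k T tscaleAl.

Lemma tscaleAr a x y : a *: (x * y) = x * (a *: y).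
Proof. by rewrite [LHS](esym (linear_fZ (tmul_linearr x) a y)). Qed.

HB.instance Definition _ := GRing.Lalgebra_isAlgebra.Build k T tscaleAr.

Lemma pureM (a a' : A) (b b' : B) :
  (a ⊗ b) * (a' ⊗ b') = (a * a') ⊗ (b * b') :> T.
Proof. exact: tmul_pure. Qed.

Lemma tens1E : 1 = 1 ⊗ 1 :> T.
Proof. by []. Qed.

End TensorAlgebra.

(* Unfolding this quotient type makes unification very slow. *)
Global Opaque tensor.

Section FreeModule.
Variables (k : nzRingType) (K : choiceType).
Implicit Types x y : {malg k[K]}.

Definition freelift (W : lmodType k) (f : K -> W) x : W :=
  \sum_(g <- msupp x) x@_g *: f g.

Lemma freelift_sub (W : lmodType k) (f : K -> W) x (d : {fset K}) :
  (msupp x `<=` d)%fset -> freelift f x = \sum_(g <- d) x@_g *: f g.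
Proof.
move=> le_d; rewrite /freelift (big_fset_incl _ le_d) //= => g _ /mcoeff_outdom ->.
by rewrite scale0r.
Qed.

Lemma freelift_linear (W : lmodType k) (f : K -> W) : linear (freelift f).
Proof.
move=> a x y; set d := (msupp x `|` msupp y)%fset.
have sx : (msupp x `<=` d)%fset := fsubsetUl _ _.
have sy : (msupp y `<=` d)%fset := fsubsetUr _ _.
have sxy : (msupp (a *: x + y) `<=` d)%fset.
  apply: fsubset_trans (msuppD_le _ _) _.
  by apply: fsetSU; exact: msuppZ_le.
rewrite (freelift_sub f sx) (freelift_sub f sy) (freelift_sub f sxy).
rewrite scaler_sumr -big_split; apply: eq_bigr => g _ /=.
by rewrite mcoeffD mcoeffZ scalerDl scalerA.
Qed.

Lemma freeliftU (W : lmodType k) (f : K -> W) c g :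
  freelift f (mkmalgU g c) = c *: f g.
Proof. by rewrite (freelift_sub f msuppU_le) big_seq_fset1 mcoeffUU. Qed.

Lemma free_ind (P : {malg k[K]} -> Prop) :
  P 0 -> (forall x y, P x -> P y -> P (x + y)) ->
  (forall a g, P (mkmalgU g a)) -> forall x, P x.
Proof.
by move=> P0 PD PU x; rewrite (monalgE x); elim/big_ind: _ => // g _; exact: PU.
Qed.

End FreeModule.

Section GroupAlgebra.
Variables (k : fieldType) (Γ : groupType).

Definition gralg : Type := {malg k[Γ]}.

HB.instance Definition _ := GRing.Lmodule.on gralg.

Definition gbasis (g : Γ) : gralg := mkmalgU g 1.
Definition gcoef (g : Γ) (x : gralg) : k := mcoeff g x.
Definition glift (W : lmodType k) (f : Γ -> W) (x : gralg) : W := freelift f x.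

Definition gmul (x y : gralg) : gralg :=
  glift (fun g => glift (fun h => gbasis (g * h)%g) y) x.

Lemma glift_linear (W : lmodType k) (f : Γ -> W) : linear (glift f).
Proof. exact: freelift_linear. Qed.

Lemma gliftE (W : lmodType k) (f : Γ -> W) g : glift f (gbasis g) = f g.
Proof. by rewrite [LHS](freeliftU f 1 g) scale1r. Qed.

Lemma gralg_ind (P : gralg -> Prop) :
  P 0 -> (forall x y, P x -> P y -> P (x + y)) ->
  (forall a x, P x -> P (a *: x)) -> (forall g, P (gbasis g)) -> forall x, P x.
Proof.
move=> P0 PD PZ Pg; elim/free_ind => // a g.
have -> : mkmalgU g a = a *: gbasis g :> gralg.
  by apply/malgP => h; rewrite mcoeffZ !mcoeffU mulrnAr mulr1.
by apply/PZ/Pg.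
Qed.

Lemma gmul_linearl y : linear (gmul^~ y).
Proof. exact: glift_linear. Qed.

Lemma gmul_linearr x : linear (gmul x).
Proof.
move=> a y z; elim/gralg_ind: x => [|x x' Hx Hx'|b x Hx|g].
- by rewrite !(linear_f0 (gmul_linearl _)) scaler0 addr0.
- by rewrite !(linear_fD (gmul_linearl _)) Hx Hx' scalerDr addrACA.
- by rewrite !(linear_fZ (gmul_linearl _)) Hx scalerDr !scalerA mulrC.
- by rewrite /gmul !gliftE glift_linear.
Qed.

Lemma gmulU g h : gmul (gbasis g) (gbasis h) = gbasis (g * h)%g.
Proof. by rewrite /gmul !gliftE. Qed.

Lemma gmulDl : left_distributive gmul +%R.
Proof. by move=> x y z; exact: (linear_fD (gmul_linearl z)). Qed.

Lemma gmulDr : right_distributive gmul +%R.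
Proof. by move=> x y z; exact: (linear_fD (gmul_linearr x)). Qed.

Let gmul0l x : gmul 0 x = 0. Proof. exact: (linear_f0 (gmul_linearl x)). Qed.
Let gmul0r x : gmul x 0 = 0. Proof. exact: (linear_f0 (gmul_linearr x)). Qed.
Let gmulZl a x y : gmul (a *: x) y = a *: gmul x y.
Proof. exact: (linear_fZ (gmul_linearl y)). Qed.
Let gmulZr a x y : gmul x (a *: y) = a *: gmul x y.
Proof. exact: (linear_fZ (gmul_linearr x)). Qed.

Lemma gmulA : associative gmul.
Proof.
move=> x y z; elim/gralg_ind: x => [|x x' Hx Hx'|a x Hx|g].
- by rewrite !gmul0l.
- by rewrite !gmulDl Hx Hx'.
- by rewrite !gmulZl Hx.
elim/gralg_ind: y => [|y y' Hy Hy'|a y Hy|h].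
- by rewrite gmul0l !gmul0r gmul0l.
- by rewrite gmulDl !gmulDr gmulDl Hy Hy'.
- by rewrite gmulZl !gmulZr gmulZl Hy.
elim/gralg_ind: z => [|z z' Hz Hz'|a z Hz|l].
- by rewrite !gmul0r.
- by rewrite !gmulDr Hz Hz'.
- by rewrite !gmulZr Hz.
by rewrite (gmulU h l) (gmulU g h) !gmulU mulgA.
Qed.

Lemma gmul1l : left_id (gbasis 1%g) gmul.
Proof.
elim/gralg_ind => [|x y Hx Hy|a x Hx|g]; first exact: gmul0r.
- by rewrite gmulDr Hx Hy.
- by rewrite gmulZr Hx.
- by rewrite gmulU mul1g.
Qed.

Lemma gmul1r : right_id (gbasis 1%g) gmul.
Proof.
elim/gralg_ind => [|x y Hx Hy|a x Hx|g]; first exact: gmul0l.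
- by rewrite gmulDl Hx Hy.
- by rewrite gmulZl Hx.
- by rewrite gmulU mulg1.
Qed.

Lemma gone_neq0 : gbasis 1%g != 0.
Proof.
by apply/eqP => /(congr1 (mcoeff 1%g)) /eqP; rewrite mcoeffUU mcoeff0 oner_eq0.
Qed.

HB.instance Definition _ := GRing.Zmodule_isNzRing.Build gralg
  gmulA gmul1l gmul1r gmulDl gmulDr gone_neq0.

Lemma gscaleAl a (x y : gralg) : a *: (x * y) = a *: x * y.
Proof. by rewrite [RHS]gmulZl. Qed.

HB.instance Definition _ := GRing.Lmodule_isLalgebra.Build k gralg gscaleAl.

Lemma gscaleAr a (x y : gralg) : a *: (x * y) = x * (a *: y).
Proof. by rewrite [RHS]gmulZr. Qed.

HB.instance Definition _ := GRing.Lalgebra_isAlgebra.Build k gralg gscaleAr.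

Lemma gbasisM g h : gbasis g * gbasis h = gbasis (g * h)%g.
Proof. exact: gmulU. Qed.

Lemma gbasis1 : gbasis 1%g = 1.
Proof. by []. Qed.

Lemma gcoef_linear g : linear (gcoef g : gralg -> k^o).
Proof. by move=> a x y; rewrite /gcoef mcoeffD mcoeffZ. Qed.

Lemma gcoefE g h : gcoef g (gbasis h) = (h == g)%:R.
Proof. exact: mcoeffU. Qed.

Definition augmentation_ideal : set gralg := fun z =>
  exists s : seq (k * Γ), z = \sum_(p <- s) p.1 *: (gbasis p.2 - gbasis 1%g).

End GroupAlgebra.

Arguments gbasis {k Γ} g.
Notation "''ζ_' g" := (gbasis g) (at level 8, g at level 2, format "''ζ_' g").

Section QuasiHopfDef.
Variables (k : fieldType) (A : algType k).

Definition tlift3 (W : zmodType) (f : A -> A -> A -> W)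
  (t : (A ⊗ (A ⊗ A))%type) : W := tlift (fun a => tlift (f a)) t.

(* Tensor powers are nested to the right. For D = Δ, [cop_l] is Δ ⊗ id and
   [cop_r] is id ⊗ Δ; [cop3_i] applies Δ to the i-th factor of A ⊗ (A ⊗ A).
   A four-fold Φ ⊗ 1 or 1 ⊗ Φ is [unit_r Φ] or [unit_l Φ]. *)
Section Legs.
Variable D : A -> (A ⊗ A)%type.
Local Notation A2 := (A ⊗ A)%type.
Local Notation A3 := (A ⊗ (A ⊗ A))%type.
Local Notation A4 := (A ⊗ (A ⊗ (A ⊗ A)))%type.

Definition cop_l (t : A2) : A3 := tassoc (tmap D id t).
Definition cop_r (t : A2) : A3 := tmap id D t.
Definition cop3_1 (t : A3) : A4 := tassoc (tmap D id t).
Definition cop3_2 (t : A3) : A4 := tmap id cop_l t.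
Definition cop3_3 (t : A3) : A4 := tmap id cop_r t.
Definition unit_l (t : A3) : A4 := 1 ⊗ t.
Definition unit_r (t : A3) : A4 := tmap id (tmap id (fun c => c ⊗ 1)) t.
End Legs.

Record quasiHopf := QuasiHopf {
  cop : A -> (A ⊗ A)%type;
  eps : A -> k;
  Phi : (A ⊗ (A ⊗ A))%type;
  Phi_inv : (A ⊗ (A ⊗ A))%type;
  antip : A -> A;
  qalpha : A;
  qbeta : A;
  cop_linear : linear cop;
  cop_monoid : monoid_morphism cop;
  eps_linear : linear (eps : A -> k^o);
  eps_monoid : monoid_morphism eps;
  PhiK : Phi * Phi_inv = 1;
  PhiVK : Phi_inv * Phi = 1;
  antip_linear : linear antip;
  antip1 : antip 1 = 1;
  antipM : forall x y, antip (x * y) = antip y * antip x;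
  pentagon : unit_l Phi * cop3_2 cop Phi * unit_r Phi
             = cop3_3 cop Phi * cop3_1 cop Phi;
  quasi_coassoc : forall x,
    Phi * cop_l cop (cop x) = cop_r cop (cop x) * Phi;
  Phi_counit : tmap id (tlift (fun b c => eps b *: c)) Phi = 1 ⊗ 1;
  counit_r : forall x, tlift (fun a b => eps b *: a) (cop x) = x;
  counit_l : forall x, tlift (fun a b => eps a *: b) (cop x) = x;
  antip_alpha : forall x,
    tlift (fun a b => antip a * qalpha * b) (cop x) = eps x *: qalpha;
  antip_beta : forall x,
    tlift (fun a b => a * qbeta * antip b) (cop x) = eps x *: qbeta;
  Phi_zigzag : tlift3 (fun a b c => a * qbeta * antip b * qalpha * c) Phi = 1;
  Phi_inv_zigzag :
    tlift3 (fun a b c => antip a * qalpha * b * qbeta * antip c) Phi_inv = 1;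
  eps_alpha : eps qalpha = 1;
  eps_beta : eps qbeta = 1
}.

End QuasiHopfDef.

Section TensorSubspaces.
Variables (k : fieldType) (U V : lmodType k).

(* The image of P ⊗ Q in U ⊗ V, for subspaces P and Q. *)
Definition tens_sub (P : set U) (Q : set V) : set (U ⊗ V)%type := fun t =>
  exists s : seq (U * V),
    (forall p, p \in s -> P p.1 /\ Q p.2) /\ t = \sum_(p <- s) p.1 ⊗ p.2.

End TensorSubspaces.

Section Morphisms.
Variables (k : fieldType) (A B : algType k).
Variables (HA : quasiHopf A) (HB : quasiHopf B).

Record qHopf_morphism (f : A -> B) : Prop := QHopfMorphism {
  qm_linear : linear f;
  qm_monoid : monoid_morphism f;
  qm_cop : forall x, cop HB (f x) = tmap f f (cop HA x);
  qm_eps : forall x, eps HB (f x) = eps HA x;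
  qm_antip : forall x, antip HB (f x) = f (antip HA x);
  qm_Phi : tmap f (tmap f f) (Phi HA) = Phi HB;
  qm_alpha : f (qalpha HA) = qalpha HB;
  qm_beta : f (qbeta HA) = qbeta HB
}.

Record qHopf_ideal (L : set A) : Prop := QHopfIdeal {
  qi_0 : L 0;
  qi_linear : forall a x y, L x -> L y -> L (a *: x + y);
  qi_mull : forall a x, L x -> L (a * x);
  qi_mulr : forall a x, L x -> L (x * a);
  qi_cop : forall x, L x -> exists s t,
    [/\ tens_sub L setT s, tens_sub setT L t & cop HA x = s + t];
  qi_eps : forall x, L x -> eps HA x = 0;
  qi_antip : forall x, L x -> L (antip HA x)
}.

Definition group_like (x : A) : Prop := cop HA x = x ⊗ x /\ eps HA x = 1.

Definition is_unit (x : A) : Prop := exists y, x * y = 1 /\ y * x = 1.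

End Morphisms.

Section Graded.
Variables (k : fieldType) (Γ : groupType) (A : algType k).

Record gradedQHopf := GradedQHopf {
  gqHopf :> quasiHopf A;
  hcomp : Γ -> set A;
  hcomp0 : forall g, hcomp g 0;
  hcomp_linear : forall g a x y, hcomp g x -> hcomp g y -> hcomp g (a *: x + y);
  (* A is the direct sum of the [hcomp g] *)
  hcomp_direct : forall x, exists! z : {malg A[Γ]},
    (forall g, hcomp g z@_g) /\ x = \sum_(g <- msupp z) z@_g;
  hcompM : forall g h x y, hcomp g x -> hcomp h y -> hcomp (g * h)%g (x * y);
  hcomp_cop : forall g x,
    hcomp g x -> tens_sub (hcomp g) (hcomp g) (cop gqHopf x);
  hcomp_antip : forall g x, hcomp g x -> hcomp g^-1%g (antip gqHopf x);
  hcomp_Phi : tens_sub (hcomp 1%g) (tens_sub (hcomp 1%g) (hcomp 1%g)) (Phi gqHopf);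
  hcomp_alpha : hcomp 1%g (qalpha gqHopf);
  hcomp_beta : hcomp 1%g (qbeta gqHopf)
}.

Variable G : gradedQHopf.

Definition faithfully_graded : Prop := forall g, exists x, hcomp G g x /\ x <> 0.

Definition hdecomp (x : A) : {malg A[Γ]} := projT1 (cid (hcomp_direct G x)).

Definition hproj (g : Γ) (x : A) : A := (hdecomp x)@_g.

Definition grading_map (x : A) : gralg k Γ :=
  \sum_(g <- msupp (hdecomp x)) eps G (hproj g x) *: 'ζ_g.

Definition augmented (L : set A) : Prop := (grading_map @` L)%classic = @augmentation_ideal k Γ.

End Graded.

Definition graded_morphism (k : fieldType) (Γ : groupType) (A B : algType k)
  (GA : gradedQHopf Γ A) (GB : gradedQHopf Γ B) (f : A -> B) : Prop :=
  qHopf_morphism GA GB f /\ forall g x, hcomp GA g x -> hcomp GB g (f x).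

Definition graded_iso (k : fieldType) (Γ : groupType) (A B : algType k)
  (GA : gradedQHopf Γ A) (GB : gradedQHopf Γ B) (f : A -> B) : Prop :=
  graded_morphism GA GB f /\ bijective f.

Section TmapMore.
Variable k : fieldType.

Lemma tlift_ext (U V : lmodType k) (W : zmodType) (f g : U -> V -> W) t :
  (forall u v, f u v = g u v) -> tlift f t = tlift g t.
Proof. by move=> fg; apply: eq_bigr => p _; rewrite fg. Qed.

Lemma tlift_fun (U V W W' : lmodType k) (f : U -> V -> W) (h : W -> W') t :
  linear h -> h (tlift f t) = tlift (fun u v => h (f u v)) t.
Proof.
move=> lh; rewrite /tlift; elim: (repr t) => [|p s IH].
  by rewrite !big_nil (linear_f0 lh).
by rewrite !big_cons (linear_fD lh) IH.
Qed.

Lemma tlift_tmap (U U' V V' W : lmodType k) (u : U -> U') (v : V -> V')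
  (f : U' -> V' -> W) t : linear u -> linear v -> bilin f ->
  tlift f (tmap u v t) = tlift (fun a b => f (u a) (v b)) t.
Proof.
move=> lu lv bf; have bfuv := bilin_comp lu lv bf.
move: t; apply: tens_ext.
- exact: linear_comp (tmap_linear lu lv) (tlift_is_linear bf).
- exact: tlift_is_linear bfuv.
- by move=> a b; rewrite (tmapE lu lv) (tliftE bf) (tliftE bfuv).
Qed.

Lemma tmap_ext (U U' V V' : lmodType k) (f f' : U -> U') (g g' : V -> V') t :
  f =1 f' -> g =1 g' -> tmap f g t = tmap f' g' t.
Proof. by move=> ff gg; apply: tlift_ext => u v; rewrite ff gg. Qed.

Lemma tmap_comp (U U' U'' V V' V'' : lmodType k) (f : U -> U') (f' : U' -> U'')
  (g : V -> V') (g' : V' -> V'') t :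
  linear f -> linear f' -> linear g -> linear g' ->
  tmap f' g' (tmap f g t) = tmap (fun x => f' (f x)) (fun x => g' (g x)) t.
Proof. by move=> lf lf' lg lg'; rewrite /tmap tlift_tmap //; exact: tmap_bilin. Qed.

Lemma tmap_id (U V : lmodType k) (t : (U ⊗ V)%type) : tmap id id t = t.
Proof. by rewrite [RHS]tensorE. Qed.

Lemma tmap_can (U U' V V' : lmodType k) (f : U -> U') (f' : U' -> U)
  (g : V -> V') (g' : V' -> V) : linear f -> linear f' -> linear g -> linear g' ->
  cancel f f' -> cancel g g' -> cancel (tmap f g) (tmap f' g').
Proof.
move=> lf lf' lg lg' fK gK t; rewrite tmap_comp // -[RHS]tmap_id.
exact: tmap_ext.
Qed.

Lemma tassoc_nat (U U' V V' W W' : lmodType k) (f : U -> U') (g : V -> V')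
  (h : W -> W') t : linear f -> linear g -> linear h ->
  tmap f (tmap g h) (tassoc t) = tassoc (tmap (tmap f g) h t).
Proof.
move=> lf lg lh; have lgh := tmap_linear lg lh; have lfg := tmap_linear lf lg.
have L1 : linear (fun t => tmap f (tmap g h) (tassoc t)).
  exact: linear_comp (@tassoc_linear _ _ _ _) (tmap_linear lf lgh).
have L2 : linear (fun t => tassoc (tmap (tmap f g) h t)).
  exact: linear_comp (tmap_linear lfg lh) (@tassoc_linear _ _ _ _).
move: t; apply: (tens_ext L1 L2) => t w.
elim/tens_ind: t => [|x y Hx Hy|u v].
- by rewrite pure0l (linear_f0 L1) (linear_f0 L2).
- by rewrite pureDl (linear_fD L1) (linear_fD L2) Hx Hy.
- by rewrite tassocE !tmapE // tassocE.
Qed.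

Lemma tmapM (A A' B B' : algType k) (f1 f2 f : A -> A') (g1 g2 g : B -> B') s t :
  linear f1 -> linear f2 -> linear f -> linear g1 -> linear g2 -> linear g ->
  (forall x y, f (x * y) = f1 x * f2 y) -> (forall x y, g (x * y) = g1 x * g2 y) ->
  tmap f g (s * t) = tmap f1 g1 s * tmap f2 g2 t.
Proof.
move=> lf1 lf2 lf lg1 lg2 lg fM gM.
have L := tmap_linear lf lg; have L1 := tmap_linear lf1 lg1.
have L2 := tmap_linear lf2 lg2.
elim/tens_ind: s => [|x y Hx Hy|a b].
- by rewrite mul0r (linear_f0 L) (linear_f0 L1) mul0r.
- by rewrite mulrDl (linear_fD L) (linear_fD L1) mulrDl Hx Hy.
elim/tens_ind: t => [|x y Hx Hy|c d].
- by rewrite mulr0 (linear_f0 L) (linear_f0 L2) mulr0.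
- by rewrite mulrDr (linear_fD L) (linear_fD L2) mulrDr Hx Hy.
by rewrite pureM !tmapE // pureM fM gM.
Qed.

Lemma tmap_monoid (A A' B B' : algType k) (f : A -> A') (g : B -> B') :
  linear f -> linear g -> monoid_morphism f -> monoid_morphism g ->
  monoid_morphism (tmap f g).
Proof.
move=> lf lg mf mg; split; first by rewrite tens1E tmapE // mf.1 mg.1.
by move=> x y; apply: tmapM => //; [exact: mf.2 | exact: mg.2].
Qed.

Definition trilin (A W : lmodType k) (f : A -> A -> A -> W) :=
  (forall b c, linear (fun a => f a b c)) /\ (forall a, bilin (f a)).

Lemma trilin_bilin (A W : lmodType k) (f : A -> A -> A -> W) : trilin f ->
  bilin (fun a => tlift (f a)).
Proof.
move=> tf; split=> [t|a]; last exact: tlift_is_linear (tf.2 a).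
move=> c x y; rewrite /tlift scaler_sumr -big_split /=.
by apply: eq_bigr => p _; rewrite tf.1.
Qed.

Lemma tlift3_tmap (A B : algType k) (W : lmodType k) (u : B -> A)
  (f : A -> A -> A -> W) t : linear u -> trilin f ->
  tlift3 f (tmap u (tmap u u) t) = tlift3 (fun a b c => f (u a) (u b) (u c)) t.
Proof.
move=> lu tf; rewrite /tlift3 (tlift_tmap _ lu (tmap_linear lu lu) (trilin_bilin tf)).
by apply: tlift_ext => a s; rewrite (tlift_tmap _ lu lu (tf.2 _)).
Qed.

Lemma tlift3_fun (B : algType k) (W W' : lmodType k) (f : B -> B -> B -> W)
  (h : W -> W') t : linear h ->
  h (tlift3 f t) = tlift3 (fun a b c => h (f a b c)) t.
Proof.
move=> lh; rewrite /tlift3 (tlift_fun _ _ lh); apply: tlift_ext => a s.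
exact: tlift_fun.
Qed.

Lemma tlift3_ext (B : algType k) (W : lmodType k) (f g : B -> B -> B -> W) t :
  (forall a b c, f a b c = g a b c) -> tlift3 f t = tlift3 g t.
Proof. by move=> fg; apply: tlift_ext => a s; apply: tlift_ext => b c. Qed.

Lemma tens_sub_tmap (U V : lmodType k) (P : set U) (Q : set V) p q t :
  linear p -> linear q -> (forall x, P x -> p x = x) -> (forall x, Q x -> q x = x) ->
  tens_sub P Q t -> tmap p q t = t.
Proof.
move=> lp lq pP qQ [s [sP ->]].
elim: s sP => [|x s IH] sP; first by rewrite big_nil (linear_f0 (tmap_linear lp lq)).
rewrite big_cons (linear_fD (tmap_linear lp lq)) IH ?tmapE //.
  by have [/pP-> /qQ->] := sP x (mem_head _ _).
by move=> y ys; apply: sP; rewrite inE ys orbT.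
Qed.

Lemma tens_sub_ind (U V : lmodType k) (P : set U) (Q : set V)
    (R : (U ⊗ V)%type -> Prop) :
  R 0 -> (forall x y, R x -> R y -> R (x + y)) ->
  (forall u v, P u -> Q v -> R (u ⊗ v)) -> forall t, tens_sub P Q t -> R t.
Proof.
move=> R0 RD Rp t [s [sP ->]].
elim: s sP => [|x s IH] sP; first by rewrite big_nil.
rewrite big_cons; apply: RD.
  by have [Px Qx] := sP x (mem_head _ _); exact: Rp.
by apply: IH => y ys; apply: sP; rewrite inE ys orbT.
Qed.

Lemma scale_bilinr (A : algType k) (e : A -> k) : linear (e : A -> k^o) ->
  bilin (fun a b : A => e b *: a).
Proof.
move=> le; split=> a c x y /=.
  by rewrite scalerDr !scalerA mulrC.
by rewrite le scalerDl scalerA.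
Qed.

Lemma scale_bilinl (A : algType k) (e : A -> k) : linear (e : A -> k^o) ->
  bilin (fun a b : A => e a *: b).
Proof.
move=> le; split=> a c x y /=.
  by rewrite le scalerDl scalerA.
by rewrite scalerDr !scalerA mulrC.
Qed.

Lemma mulSl_bilin (A : algType k) (S : A -> A) (al : A) : linear S ->
  bilin (fun a b : A => S a * al * b).
Proof.
move=> lS; split=> a c x y /=.
  by rewrite lS !mulrDl -!scalerAl.
by rewrite mulrDr -scalerAr.
Qed.

Lemma mulSr_bilin (A : algType k) (S : A -> A) (be : A) : linear S ->
  bilin (fun a b : A => a * be * S b).
Proof.
move=> lS; split=> a c x y /=.
  by rewrite !mulrDl -!scalerAl.
by rewrite lS mulrDr -scalerAr.
Qed.

Lemma zig_trilin (A : algType k) (S : A -> A) (al be : A) : linear S ->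
  trilin (fun a b c : A => a * be * S b * al * c).
Proof.
move=> lS; split=> [b c|a]; last split=> z c x y /=.
- by move=> r x y; rewrite !mulrDl -!scalerAl.
- by rewrite lS !mulrDr !mulrDl -!scalerAr -!scalerAl.
- by rewrite mulrDr -scalerAr.
Qed.

Lemma zag_trilin (A : algType k) (S : A -> A) (al be : A) : linear S ->
  trilin (fun a b c : A => S a * al * b * be * S c).
Proof.
move=> lS; split=> [b c|a]; last split=> z c x y /=.
- by move=> r x y; rewrite lS !mulrDl -!scalerAl.
- by rewrite !mulrDr !mulrDl -!scalerAr -!scalerAl.
- by rewrite lS mulrDr -scalerAr.
Qed.

End TmapMore.

Section Naturality.
Variables (k : fieldType) (A B : algType k) (f : B -> A).
Variables (DB : B -> (B ⊗ B)%type) (DA : A -> (A ⊗ A)%type).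
Hypotheses (lf : linear f) (lDB : linear DB) (lDA : linear DA).
Hypothesis fD : forall x, tmap f f (DB x) = DA (f x).

Let f2 := tmap f f.
Let f3 := tmap f f2.
Let f4 := tmap f f3.
Let lf2 : linear f2 := tmap_linear lf lf.
Let lf3 : linear f3 := tmap_linear lf lf2.
Let lidA := @linear_id k A.
Let lidB := @linear_id k B.

Lemma cop_l_nat t : f3 (cop_l DB t) = cop_l DA (f2 t).
Proof.
rewrite /cop_l /f3 /f2 tassoc_nat // !tmap_comp //.
by congr tassoc; apply: tmap_ext.
Qed.

Lemma cop_r_nat t : f3 (cop_r DB t) = cop_r DA (f2 t).
Proof. by rewrite /cop_r /f3 /f2 !tmap_comp //; apply: tmap_ext. Qed.

Lemma cop_l_linear : linear (cop_l DA).
Proof. exact: linear_comp (tmap_linear lDA lidA) (@tassoc_linear _ _ _ _). Qed.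

Lemma cop_r_linear : linear (cop_r DA).
Proof. exact: tmap_linear lidA lDA. Qed.

End Naturality.

Section Naturality4.
Variables (k : fieldType) (A B : algType k) (f : B -> A).
Variables (DB : B -> (B ⊗ B)%type) (DA : A -> (A ⊗ A)%type).
Hypotheses (lf : linear f) (lDB : linear DB) (lDA : linear DA).
Hypothesis fD : forall x, tmap f f (DB x) = DA (f x).

Let f2 := tmap f f.
Let f3 := tmap f f2.
Let f4 := tmap f f3.
Let lf2 : linear f2 := tmap_linear lf lf.
Let lf3 : linear f3 := tmap_linear lf lf2.
Let lidA := @linear_id k A.
Let lidB := @linear_id k B.
Let lA l := @cop_l_linear k A DA l.
Let lB l := @cop_l_linear k B DB l.

Lemma cop3_1_nat t : f4 (cop3_1 DB t) = cop3_1 DA (f3 t).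
Proof.
rewrite /cop3_1 /f4 /f3 tassoc_nat // !tmap_comp //.
by congr tassoc; apply: tmap_ext.
Qed.

Lemma cop3_2_nat t : f4 (cop3_2 DB t) = cop3_2 DA (f3 t).
Proof.
rewrite /cop3_2 /f4 /f3 !tmap_comp //; try exact: cop_l_linear.
by apply: tmap_ext => // x; exact: cop_l_nat.
Qed.

Lemma cop3_3_nat t : f4 (cop3_3 DB t) = cop3_3 DA (f3 t).
Proof.
rewrite /cop3_3 /f4 /f3 !tmap_comp //; try exact: cop_r_linear.
by apply: tmap_ext => // x; exact: cop_r_nat.
Qed.

Hypothesis f1 : f 1 = 1.

Lemma unit_l_nat t : f4 (unit_l t) = unit_l (f3 t).
Proof. by rewrite /unit_l /f4 tmapE // f1. Qed.

Lemma unit_r_nat t : f4 (unit_r t) = unit_r (f3 t).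
Proof.
have l1 (C : algType k) : linear (fun c : C => c ⊗ (1 : C)).
  by move=> a x y; rewrite pureDl pureZl.
have l2 (C : algType k) : linear (tmap (@id C) (fun c : C => c ⊗ (1 : C))).
  exact: tmap_linear (@linear_id _ _) (l1 C).
rewrite /unit_r /f4 /f3 /f2 !tmap_comp //; try exact: l2.
apply: tmap_ext => // s; rewrite !tmap_comp //; try exact: l1.
by apply: tmap_ext => // c; rewrite tmapE // f1.
Qed.

Hypothesis fM : {morph f : x y / x * y}.

Let mf : monoid_morphism f := (f1, fM).
Let mf3 : monoid_morphism f3 := tmap_monoid lf lf2 mf (tmap_monoid lf lf mf mf).
Let mf4 : monoid_morphism f4 := tmap_monoid lf lf3 mf mf3.

Lemma pentagon_nat F :
  (f4 (unit_l F * cop3_2 DB F * unit_r F)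
    = unit_l (f3 F) * cop3_2 DA (f3 F) * unit_r (f3 F)) *
  (f4 (cop3_3 DB F * cop3_1 DB F) = cop3_3 DA (f3 F) * cop3_1 DA (f3 F)).
Proof.
by rewrite !mf4.2 unit_l_nat cop3_2_nat unit_r_nat cop3_3_nat cop3_1_nat.
Qed.

End Naturality4.

Section NaturalityEps.
Variables (k : fieldType) (A B : algType k) (f : B -> A).
Variables (eB : B -> k) (eA : A -> k).
Hypotheses (lf : linear f) (leB : linear (eB : B -> k^o)) (leA : linear (eA : A -> k^o)).
Hypothesis fe : forall x, eA (f x) = eB x.

Lemma counit_r_nat t :
  f (tlift (fun a b => eB b *: a) t) = tlift (fun a b => eA b *: a) (tmap f f t).
Proof.
rewrite (tlift_tmap _ lf lf (scale_bilinr leA)) (tlift_fun _ _ lf).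
by apply: tlift_ext => a b; rewrite fe (linear_fZ lf).
Qed.

Lemma counit_l_nat t :
  f (tlift (fun a b => eB a *: b) t) = tlift (fun a b => eA a *: b) (tmap f f t).
Proof.
rewrite (tlift_tmap _ lf lf (scale_bilinl leA)) (tlift_fun _ _ lf).
by apply: tlift_ext => a b; rewrite fe (linear_fZ lf).
Qed.

Lemma Phi_counit_nat F :
  tmap f f (tmap id (tlift (fun b c => eB b *: c)) F) =
  tmap id (tlift (fun b c => eA b *: c)) (tmap f (tmap f f) F).
Proof.
have lA := tlift_is_linear (scale_bilinl leA).
have lB := tlift_is_linear (scale_bilinl leB).
rewrite (tmap_comp _ (@linear_id _ _) lf lB lf).
rewrite (tmap_comp _ lf (@linear_id _ _) (tmap_linear lf lf) lA).
by apply: tmap_ext => // x; exact: counit_l_nat.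
Qed.

End NaturalityEps.

Section NaturalityAntip.
Variables (k : fieldType) (A B : algType k) (f : B -> A).
Variables (SB : B -> B) (aB bB : B) (SA : A -> A).
Hypotheses (lf : linear f) (lSA : linear SA).
Hypotheses (fS : forall x, f (SB x) = SA (f x)) (fM : {morph f : x y / x * y}).

Lemma alpha_nat t : f (tlift (fun a b => SB a * aB * b) t) =
  tlift (fun a b => SA a * f aB * b) (tmap f f t).
Proof.
rewrite (tlift_tmap _ lf lf (mulSl_bilin _ lSA)) (tlift_fun _ _ lf).
by apply: tlift_ext => a b; rewrite !fM fS.
Qed.

Lemma beta_nat t : f (tlift (fun a b => a * bB * SB b) t) =
  tlift (fun a b => a * f bB * SA b) (tmap f f t).
Proof.
rewrite (tlift_tmap _ lf lf (mulSr_bilin _ lSA)) (tlift_fun _ _ lf).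
by apply: tlift_ext => a b; rewrite !fM fS.
Qed.

Lemma zig_nat t : f (tlift3 (fun a b c => a * bB * SB b * aB * c) t) =
  tlift3 (fun a b c => a * f bB * SA b * f aB * c) (tmap f (tmap f f) t).
Proof.
rewrite (tlift3_tmap _ lf (zig_trilin _ _ lSA)) (tlift3_fun _ _ lf).
by apply: tlift3_ext => a b c; rewrite !fM fS.
Qed.

Lemma zag_nat t : f (tlift3 (fun a b c => SB a * aB * b * bB * SB c) t) =
  tlift3 (fun a b c => SA a * f aB * b * f bB * SA c) (tmap f (tmap f f) t).
Proof.
rewrite (tlift3_tmap _ lf (zag_trilin _ _ lSA)) (tlift3_fun _ _ lf).
by apply: tlift3_ext => a b c; rewrite !fM !fS.
Qed.

End NaturalityAntip.

Section HSum.
Variables (A : nzRingType) (K : choiceType).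

Definition hsum (z : {malg A[K]}) : A := \sum_(g <- msupp z) z@_g.

Lemma hsum_linear a x y : hsum (a *: x + y) = a * hsum x + hsum y.
Proof.
have hsumE z : hsum z = freelift (fun _ => 1 : A^o) z.
  by apply: eq_bigr => g _; rewrite -[RHS]mulr1 mulr1 [RHS]mulr1.
by rewrite !hsumE; exact: (@freelift_linear A K A^o (fun=> 1) a x y).
Qed.

Lemma hsum0 : hsum 0 = 0.
Proof. by rewrite /hsum msupp0 big_seq_fset0. Qed.

Lemma hsumU g x : hsum (mkmalgU g x) = x.
Proof.
rewrite /hsum msuppU; case: eqP => [->|_]; first by rewrite big_seq_fset0.
by rewrite big_seq_fset1 mcoeffUU.
Qed.

End HSum.

Section GradedTheory.
Variables (k : fieldType) (Γ : groupType) (A : algType k).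
Variable G : gradedQHopf Γ A.
Implicit Types (x y : A) (z : {malg A[Γ]}) (g h : Γ).

Lemma hdecompP x : (forall g, hcomp G g (hproj G g x)) /\ x = hsum (hdecomp G x).
Proof. by rewrite /hproj /hdecomp; case: (cid _) => z [[? ?] ?]. Qed.

Lemma hdecomp_uniq x z : (forall g, hcomp G g z@_g) -> x = hsum z ->
  hdecomp G x = z.
Proof. by rewrite /hdecomp; case: (cid _) => z' [? u] /= ? ?; exact: u. Qed.

Lemma hproj_mem g x : hcomp G g (hproj G g x).
Proof. by have [] := hdecompP x. Qed.

Lemma hproj_linear g : linear (hproj G g).
Proof.
move=> a x y; have [xP xE] := hdecompP x; have [yP yE] := hdecompP y.
rewrite {1}/hproj (@hdecomp_uniq _ (a%:A *: hdecomp G x + hdecomp G y)).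
- by rewrite mcoeffD mcoeffZ mulr_algl.
- by move=> h; rewrite mcoeffD mcoeffZ mulr_algl; apply: hcomp_linear; [exact: xP|exact: yP].
- by rewrite hsum_linear mulr_algl -xE -yE.
Qed.

Lemma hproj_mull g a x : hcomp G 1%g a -> hproj G g (a * x) = a * hproj G g x.
Proof.
move=> a1; have [xP xE] := hdecompP x.
rewrite {1}/hproj (@hdecomp_uniq _ (a *: hdecomp G x + 0)).
- by rewrite addr0 mcoeffZ.
- by move=> h; rewrite addr0 mcoeffZ -[h in hcomp G h]mul1g; apply: hcompM => //; exact: xP.
- by rewrite hsum_linear hsum0 addr0 -xE.
Qed.

Lemma hprojE g h x : hcomp G g x -> hproj G h x = x *+ (g == h).
Proof.
move=> gx; rewrite /hproj (@hdecomp_uniq _ (mkmalgU g x)).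
- by rewrite mcoeffU.
- move=> h'; rewrite mcoeffU; case: eqP => [<-//|_]; exact: hcomp0.
- by rewrite hsumU.
Qed.

Lemma hproj_id g x : hcomp G g x -> hproj G g x = x.
Proof. by move=> gx; rewrite (hprojE _ gx) eqxx. Qed.

Lemma hsum_hproj x : x = \sum_(g <- msupp (hdecomp G x)) hproj G g x.
Proof. exact: (hdecompP x).2. Qed.

Lemma grading_mapE g x : hcomp G g x -> grading_map G x = eps G x *: 'ζ_g.
Proof.
move=> gx; rewrite /grading_map; have E : hdecomp G x = mkmalgU g x.
  apply: hdecomp_uniq; last by rewrite hsumU.
  move=> h; rewrite mcoeffU; case: eqP => [<-//|_]; exact: hcomp0.
rewrite E msuppU; case: eqP => [->|_].
  by rewrite big_seq_fset0 (linear_f0 (eps_linear G)) scale0r.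
by rewrite big_seq_fset1 hproj_id.
Qed.

Lemma hcompD g x y : hcomp G g x -> hcomp G g y -> hcomp G g (x + y).
Proof. by move=> gx gy; rewrite -[x]scale1r; exact: hcomp_linear. Qed.

Lemma hcompZ g (a : k) x : hcomp G g x -> hcomp G g (a *: x).
Proof. by move=> gx; rewrite -[_ *: _]addr0; apply: hcomp_linear => //; exact: hcomp0. Qed.

Lemma hcomp1 : hcomp G 1%g 1.
Proof.
suff -> : 1 = hproj G 1%g 1 by exact: hproj_mem.
set e := hproj G 1%g 1.
have eP g x : hcomp G g x -> x = e * x.
  move=> gx; have [P1 E1] := hdecompP 1.
  have E : hdecomp G x = \sum_(h <- msupp (hdecomp G 1)) mkmalgU (h * g)%g (hproj G h 1 * x).
    apply: hdecomp_uniq.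
      move=> l; rewrite raddf_sum; apply: (@big_ind _ (hcomp G l)).
      - exact: hcomp0.
      - by move=> *; exact: hcompD.
      - move=> h _; rewrite /= mcoeffU; case: eqP => [<-|_]; last exact: hcomp0.
        by apply: hcompM.
    rewrite -[LHS]mul1r {1}E1 {1}/hsum mulr_suml.
    elim: (enum_fset _) => [|h s IH]; first by rewrite !big_nil hsum0.
    by rewrite !big_cons IH -[X in hsum (X + _)]scale1r hsum_linear mul1r hsumU.
  rewrite -{1}(hproj_id gx) {1}/hproj E raddf_sum /=.
  under eq_bigr do rewrite mcoeffU -(inj_eq (mulIg g^-1%g)) mulgK mulgV.
  rewrite [LHS](_ : _ = \sum_(h <- msupp (hdecomp G 1)) (mcoeff h (hdecomp G 1)) *+ (h == 1%g) * x).
    rewrite -mulr_suml; congr (_ * _).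
    rewrite /e /hproj [in RHS](monalgE (hdecomp G 1)) raddf_sum /=.
    by apply: eq_bigr => h _; rewrite mcoeffU.
  by apply: eq_bigr => h _; rewrite mulrnAl.
have s1 := hsum_hproj 1.
rewrite -[RHS]mulr1 [in RHS]s1 [LHS]s1 mulr_sumr.
by apply: eq_bigr => g _; apply: eP; exact: hproj_mem.
Qed.

End GradedTheory.

Section Neutral.
Variables (k : fieldType) (Γ : groupType) (A : algType k).
Variable G : gradedQHopf Γ A.

Definition neutral_pred : {pred A} := fun x => `[< hcomp G 1%g x >].

Lemma neutral_predP x : reflect (hcomp G 1%g x) (x \in neutral_pred).
Proof. exact: asboolP. Qed.

Lemma neutral_closed : GRing.subsemialg_closed neutral_pred.
Proof.
have cZ a x : x \in neutral_pred -> a *: x \in neutral_pred.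
  by move=> /neutral_predP hx; apply/neutral_predP/hcompZ.
have cD x y : x \in neutral_pred -> y \in neutral_pred -> x + y \in neutral_pred.
  by move=> /neutral_predP hx /neutral_predP hy; apply/neutral_predP/hcompD.
split=> //; first exact/neutral_predP/hcomp1.
  by split=> //; exact/neutral_predP/hcomp0.
move=> x y /neutral_predP hx /neutral_predP hy; apply/neutral_predP.
by rewrite -[1%g]mul1g; exact: hcompM.
Qed.

(* A_e, as a subtype of A. *)
Record neutral : Type := Neutral {nval :> A; _ : nval \in neutral_pred}.

HB.instance Definition _ := [isSub of neutral for nval].
HB.instance Definition _ := [Choice of neutral by <:].
HB.instance Definition _ :=
  GRing.SubChoice_isSubAlgebra.Build k A neutral_pred neutral neutral_closed.

End Neutral.

Section NeutralQuasiHopf.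
Variables (k : fieldType) (Γ : groupType) (A : algType k).
Variable G : gradedQHopf Γ A.
Local Notation E := (neutral G).

Lemma hproj1_neutral x : hproj G 1%g x \in neutral_pred G.
Proof. by apply/neutral_predP/hproj_mem. Qed.

(* The projection of A onto A_e along the other components. *)
Definition nproj (x : A) : E := Neutral (hproj1_neutral x).

Lemma nval_linear : linear (@nval _ _ _ G).
Proof. by []. Qed.

Lemma nval_monoid : monoid_morphism (@nval _ _ _ G).
Proof. by []. Qed.

Lemma nval_hcomp (x : E) : hcomp G 1%g (nval x).
Proof. by apply/neutral_predP; case: x. Qed.

Lemma nval_inj : injective (@nval _ _ _ G).
Proof. exact: val_inj. Qed.

Lemma nprojK x : hcomp G 1%g x -> nval (nproj x) = x.
Proof. exact: hproj_id. Qed.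

Lemma nvalK : cancel (@nval _ _ _ G) nproj.
Proof. by move=> x; apply: nval_inj; apply/nprojK/nval_hcomp. Qed.

Lemma nproj_linear : linear nproj.
Proof. by move=> a x y; apply: nval_inj; exact: hproj_linear. Qed.

Let v := @nval _ _ _ G.
Let lv : linear v := nval_linear.
Let mv : monoid_morphism v := nval_monoid.
Let v2 := tmap v v.
Let v3 := tmap v v2.
Let v4 := tmap v v3.
Let lv2 : linear v2 := tmap_linear lv lv.
Let lv3 : linear v3 := tmap_linear lv lv2.
Let mv2 : monoid_morphism v2 := tmap_monoid lv lv mv mv.
Let mv3 : monoid_morphism v3 := tmap_monoid lv lv2 mv mv2.
Let p := nproj.
Let lp : linear p := nproj_linear.
Let p2 := tmap p p.
Let lp2 : linear p2 := tmap_linear lp lp.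
Let p3 := tmap p p2.
Let lp3 : linear p3 := tmap_linear lp lp2.

Let v2K : cancel v2 p2. Proof. exact: tmap_can nvalK nvalK. Qed.
Let v3K : cancel v3 p3. Proof. exact: tmap_can nvalK v2K. Qed.
Let v4K : cancel v4 (tmap p p3). Proof. exact: tmap_can nvalK v3K. Qed.

Let p2K t : tens_sub (hcomp G 1%g) (hcomp G 1%g) t -> v2 (p2 t) = t.
Proof.
move=> tP; rewrite /v2 /p2 tmap_comp //.
by apply: tens_sub_tmap tP; try exact: hproj_linear; exact: hproj_id.
Qed.

Let p3K t : tens_sub (hcomp G 1%g) (tens_sub (hcomp G 1%g) (hcomp G 1%g)) t ->
  v3 (p3 t) = t.
Proof.
move=> tP; rewrite /v3 /p3 tmap_comp //.
apply: tens_sub_tmap tP; try exact: hproj_linear; try exact: hproj_id.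
- exact: linear_comp lp2 lv2.
- exact: p2K.
Qed.

Let pM a x : hcomp G 1%g a -> v (p (a * x)) = a * v (p x).
Proof. exact: hproj_mull. Qed.

Let p2M t x : tens_sub (hcomp G 1%g) (hcomp G 1%g) t ->
  v2 (p2 (t * x)) = t * v2 (p2 x).
Proof.
have L : linear (fun x => v2 (p2 x)) := linear_comp lp2 lv2.
move: t; apply: tens_sub_ind => [|s t Hs Ht|a b Ha Hb].
- by rewrite !mul0r (linear_f0 L).
- by rewrite !mulrDl (linear_fD L) Hs Ht.
elim/tens_ind: x => [|x y Hx Hy|c d].
- by rewrite !mulr0 (linear_f0 L) mulr0.
- by rewrite !mulrDr (linear_fD L) Hx Hy -mulrDr -(linear_fD L).
by rewrite pureM /p2 /v2 !tmapE // pureM !pM.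
Qed.

Let p3M t x : tens_sub (hcomp G 1%g) (tens_sub (hcomp G 1%g) (hcomp G 1%g)) t ->
  v3 (p3 (t * x)) = t * v3 (p3 x).
Proof.
have L : linear (fun x => v3 (p3 x)) := linear_comp lp3 lv3.
move: t; apply: tens_sub_ind => [|s t Hs Ht|a b Ha Hb].
- by rewrite !mul0r (linear_f0 L).
- by rewrite !mulrDl (linear_fD L) Hs Ht.
elim/tens_ind: x => [|x y Hx Hy|c d].
- by rewrite !mulr0 (linear_f0 L) mulr0.
- by rewrite !mulrDr (linear_fD L) Hx Hy -mulrDr -(linear_fD L).
by rewrite pureM /p3 /v3 !tmapE // pureM pM // p2M.
Qed.

(* The restricted structure. All the elements projected below already lie in
   (tensor powers of) A_e, see [nval_cop] and the following lemmas. *)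
Definition ncop (x : E) : (E ⊗ E)%type := tmap nproj nproj (cop G (nval x)).
Definition neps (x : E) : k := eps G (nval x).
Definition nPhi : (E ⊗ (E ⊗ E))%type :=
  tmap nproj (tmap nproj nproj) (Phi G).
Definition nPhi_inv : (E ⊗ (E ⊗ E))%type :=
  tmap nproj (tmap nproj nproj) (Phi_inv G).
Definition nantip (x : E) : E := nproj (antip G (nval x)).
Definition nalpha : E := nproj (qalpha G).
Definition nbeta : E := nproj (qbeta G).

Local Notation nv := (@nval _ _ _ G).

Lemma nval_cop x : tmap nv nv (ncop x) = cop G (nval x).
Proof. by apply/p2K/hcomp_cop/nval_hcomp. Qed.

Lemma nval_Phi : tmap nv (tmap nv nv) nPhi = Phi G.
Proof. exact/p3K/hcomp_Phi. Qed.

Lemma nval_Phi_inv : tmap nv (tmap nv nv) nPhi_inv = Phi_inv G.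
Proof.
have E1 : Phi G * v3 (p3 (Phi_inv G)) = 1.
  rewrite -p3M; last exact: hcomp_Phi.
  by rewrite PhiK -[X in p3 X]mv3.1 v3K mv3.1.
by rewrite -[RHS]mulr1 -E1 mulrA PhiVK mul1r.
Qed.

Lemma nval_antip x : nval (nantip x) = antip G (nval x).
Proof.
apply: nprojK; have := hcomp_antip (nval_hcomp x).
by rewrite invg1.
Qed.

Lemma nval_alpha : nval nalpha = qalpha G.
Proof. exact/nprojK/hcomp_alpha. Qed.

Lemma nval_beta : nval nbeta = qbeta G.
Proof. exact/nprojK/hcomp_beta. Qed.

Let v2I := can_inj v2K.
Let v3I := can_inj v3K.
Let v4I := can_inj v4K.
Let vI := nval_inj.
Let nc x : v2 (ncop x) = cop G (v x) := nval_cop x.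
Let nP : v3 nPhi = Phi G := nval_Phi.
Let nPi : v3 nPhi_inv = Phi_inv G := nval_Phi_inv.
Let nS x : v (nantip x) = antip G (v x) := nval_antip x.
Let na : v nalpha = qalpha G := nval_alpha.
Let nb : v nbeta = qbeta G := nval_beta.

Lemma ncop_linear : linear ncop.
Proof. exact: linear_comp (linear_comp lv (cop_linear G)) lp2. Qed.

Lemma ncop_monoid : monoid_morphism ncop.
Proof.
split=> [|x y]; apply: v2I.
  by rewrite nc mv2.1 mv.1 (cop_monoid G).1.
by rewrite mv2.2 !nc mv.2 (cop_monoid G).2.
Qed.

Lemma neps_linear : linear (neps : E -> k^o).
Proof. exact: linear_comp lv (eps_linear G). Qed.

Lemma neps_monoid : monoid_morphism neps.
Proof.
split=> [|x y]; first exact: (eps_monoid G).1.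
exact: (eps_monoid G).2.
Qed.

Lemma nantip_linear : linear nantip.
Proof. exact: linear_comp (linear_comp lv (antip_linear G)) lp. Qed.

Lemma nPhiK : nPhi * nPhi_inv = 1.
Proof. by apply: v3I; rewrite mv3.2 mv3.1 nP nPi PhiK. Qed.

Lemma nPhiVK : nPhi_inv * nPhi = 1.
Proof. by apply: v3I; rewrite mv3.2 mv3.1 nP nPi PhiVK. Qed.

Lemma nantip1 : nantip 1 = 1.
Proof. by apply: vI; rewrite -/v nS mv.1 antip1. Qed.

Lemma nantipM x y : nantip (x * y) = nantip y * nantip x.
Proof. by apply: vI; rewrite -/v mv.2 !nS mv.2 antipM. Qed.

Lemma npentagon : unit_l nPhi * cop3_2 ncop nPhi * unit_r nPhi
             = cop3_3 ncop nPhi * cop3_1 ncop nPhi.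
Proof.
have [] := pentagon_nat lv ncop_linear (cop_linear G) nc mv.1 mv.2 nPhi.
rewrite -/v2 -/v3 -/v4 nP => N1 N2.
by apply: v4I; rewrite N1 N2 pentagon.
Qed.

Lemma nquasi_coassoc x :
  nPhi * cop_l ncop (ncop x) = cop_r ncop (ncop x) * nPhi.
Proof.
have Nl := cop_l_nat lv ncop_linear (cop_linear G) nc (ncop x).
have Nr := cop_r_nat lv ncop_linear (cop_linear G) nc (ncop x).
rewrite -/v2 -/v3 nc in Nl; rewrite -/v2 -/v3 nc in Nr.
by apply: v3I; rewrite !mv3.2 Nl Nr nP quasi_coassoc.
Qed.

Lemma nPhi_counit : tmap id (tlift (fun b c => neps b *: c)) nPhi = 1 ⊗ 1.
Proof.
have N := Phi_counit_nat lv neps_linear (eps_linear G) (fun=> erefl) nPhi.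
rewrite -/v2 -/v3 nP in N.
by apply: v2I; rewrite N Phi_counit -tens1E -[LHS]mv2.1.
Qed.

Lemma ncounit_r x : tlift (fun a b => neps b *: a) (ncop x) = x.
Proof.
apply: vI; rewrite -/v (counit_r_nat lv (eps_linear G)) // -/v2.
by rewrite nc counit_r.
Qed.

Lemma ncounit_l x : tlift (fun a b => neps a *: b) (ncop x) = x.
Proof.
apply: vI; rewrite -/v (counit_l_nat lv (eps_linear G)) // -/v2.
by rewrite nc counit_l.
Qed.

Lemma nantip_alpha x :
  tlift (fun a b => nantip a * nalpha * b) (ncop x) = neps x *: nalpha.
Proof.
apply: vI; rewrite -/v (alpha_nat _ lv (antip_linear G) nS mv.2) -/v2 -/v3.
by rewrite nc na antip_alpha (linear_fZ lv) na.
Qed.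

Lemma nantip_beta x :
  tlift (fun a b => a * nbeta * nantip b) (ncop x) = neps x *: nbeta.
Proof.
apply: vI; rewrite -/v (beta_nat _ lv (antip_linear G) nS mv.2) -/v2 -/v3.
by rewrite nc nb antip_beta (linear_fZ lv) nb.
Qed.

Lemma nPhi_zigzag :
  tlift3 (fun a b c => a * nbeta * nantip b * nalpha * c) nPhi = 1.
Proof.
apply: vI; rewrite -/v (zig_nat _ _ lv (antip_linear G) nS mv.2) -/v2 -/v3.
by rewrite nP na nb Phi_zigzag.
Qed.

Lemma nPhi_inv_zigzag :
  tlift3 (fun a b c => nantip a * nalpha * b * nbeta * nantip c) nPhi_inv = 1.
Proof.
apply: vI; rewrite -/v (zag_nat _ _ lv (antip_linear G) nS mv.2) -/v2 -/v3.
by rewrite nPi na nb Phi_inv_zigzag.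
Qed.

Lemma neps_alpha : neps nalpha = 1.
Proof. by rewrite /neps nval_alpha eps_alpha. Qed.

Lemma neps_beta : neps nbeta = 1.
Proof. by rewrite /neps nval_beta eps_beta. Qed.

Definition neutral_qHopf : quasiHopf E :=
  QuasiHopf ncop_linear ncop_monoid neps_linear neps_monoid nPhiK nPhiVK
    nantip_linear nantip1 nantipM npentagon nquasi_coassoc nPhi_counit
    ncounit_r ncounit_l nantip_alpha nantip_beta nPhi_zigzag nPhi_inv_zigzag
    neps_alpha neps_beta.

End NeutralQuasiHopf.

Section GroupTensor.
Variables (k : fieldType) (Γ : groupType) (B : algType k) (H : quasiHopf B).
Local Notation KΓ := (gralg k Γ).
Local Notation C := (B ⊗ KΓ)%type.

Section Lift.
Variables (W : lmodType k) (f : B -> Γ -> W).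
Hypothesis lf : forall g, linear (f^~ g).

(* The linear map sending x ⊗ ζ_g to f x g. *)
Definition bglift (t : C) : W := tlift (fun x z => glift (f x) z) t.

Lemma bglift_bilin : bilin (fun x (z : KΓ) => glift (f x) z).
Proof.
split=> [z|x]; last exact: glift_linear.
move=> a x y /=; elim/gralg_ind: z => [|z z' Hz Hz'|b z Hz|g].
- by rewrite !(linear_f0 (glift_linear _)) scaler0 addr0.
- by rewrite !(linear_fD (glift_linear _)) Hz Hz' scalerDr addrACA.
- by rewrite !(linear_fZ (glift_linear _)) Hz scalerDr !scalerA mulrC.
- by rewrite !gliftE lf.
Qed.

Lemma bgliftE x g : bglift (x ⊗ 'ζ_g) = f x g.
Proof. by rewrite /bglift (tliftE bglift_bilin) gliftE. Qed.

Lemma bglift_linear : linear bglift.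
Proof. exact: tlift_is_linear bglift_bilin. Qed.

End Lift.

Lemma bg_ind (P : C -> Prop) : P 0 -> (forall x y, P x -> P y -> P (x + y)) ->
  (forall x g, P (x ⊗ 'ζ_g)) -> forall t, P t.
Proof.
move=> P0 PD Pg; elim/tens_ind => // x z; elim/gralg_ind: z x => [|z z' Hz Hz'|a z Hz|g] x.
- by rewrite pure0r.
- by rewrite pureDr; apply: PD.
- by rewrite pureZr -pureZl.
- exact: Pg.
Qed.

Lemma bg_ext (W : lmodType k) (f f' : C -> W) : linear f -> linear f' ->
  (forall x g, f (x ⊗ 'ζ_g) = f' (x ⊗ 'ζ_g)) -> f =1 f'.
Proof.
move=> l l' E; elim/bg_ind => [|x y Hx Hy|//]; first by rewrite (linear_f0 l) (linear_f0 l').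
by rewrite (linear_fD l) (linear_fD l') Hx Hy.
Qed.

Definition bgin (g : Γ) (x : B) : C := x ⊗ 'ζ_g.

Lemma bgin_linear g : linear (bgin g).
Proof. by move=> a x y; rewrite /bgin pureDl pureZl. Qed.

Lemma bginM g h x y : bgin (g * h)%g (x * y) = bgin g x * bgin h y.
Proof. by rewrite /bgin pureM gbasisM. Qed.

Lemma bgin1_monoid : monoid_morphism (bgin 1%g).
Proof. by split=> // x y; rewrite -[in LHS](mulg1 1%g) bginM. Qed.

Let lj g := bgin_linear g.
Let j2 g := tmap (bgin g) (bgin g).
Let j3 g := tmap (bgin g) (j2 g).
Let lj2 g : linear (j2 g) := tmap_linear (lj g) (lj g).
Let lj3 g : linear (j3 g) := tmap_linear (lj g) (lj2 g).
Let m1 := bgin1_monoid.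
Let m2 : monoid_morphism (j2 1%g) := tmap_monoid (lj _) (lj _) m1 m1.
Let m3 : monoid_morphism (j3 1%g) := tmap_monoid (lj _) (lj2 _) m1 m2.

Lemma j2M g h s t : j2 (g * h)%g (s * t) = j2 g s * j2 h t.
Proof. by apply: tmapM => // x y; exact: bginM. Qed.

Lemma j3M g h s t : j3 (g * h)%g (s * t) = j3 g s * j3 h t.
Proof. by apply: tmapM => // x y; [exact: bginM | exact: j2M]. Qed.

Definition bgcop : C -> (C ⊗ C)%type :=
  bglift (fun x g => tmap (bgin g) (bgin g) (cop H x)).
Definition bgeps : C -> k := bglift (fun x g => eps H x : k^o).
Definition bgantip : C -> C := bglift (fun x g => antip H x ⊗ 'ζ_(g^-1%g)).
Definition bgPhi : (C ⊗ (C ⊗ C))%type :=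
  tmap (bgin 1%g) (tmap (bgin 1%g) (bgin 1%g)) (Phi H).
Definition bgPhi_inv : (C ⊗ (C ⊗ C))%type :=
  tmap (bgin 1%g) (tmap (bgin 1%g) (bgin 1%g)) (Phi_inv H).
Definition bgalpha : C := qalpha H ⊗ 'ζ_(1%g).
Definition bgbeta : C := qbeta H ⊗ 'ζ_(1%g).

Let lcop g : linear (fun x => j2 g (cop H x)) :=
  linear_comp (cop_linear H) (lj2 g).
Let leps (g : Γ) : linear (fun x => eps H x : k^o) := eps_linear H.
Let lantip g : linear (fun x => antip H x ⊗ 'ζ_(g^-1%g) : C).
Proof. exact: linear_comp (antip_linear H) (lj _). Qed.

Lemma bgcopE x g : bgcop (x ⊗ 'ζ_g) = j2 g (cop H x).
Proof. exact: (bgliftE lcop). Qed.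
Lemma bgepsE x g : bgeps (x ⊗ 'ζ_g) = eps H x.
Proof. exact: (bgliftE leps). Qed.
Lemma bgantipE x g : bgantip (x ⊗ 'ζ_g) = antip H x ⊗ 'ζ_(g^-1%g).
Proof. exact: (bgliftE lantip). Qed.

Lemma bgcop_linear : linear bgcop. Proof. exact: (bglift_linear lcop). Qed.
Lemma bgeps_linear : linear (bgeps : C -> k^o).
Proof. exact: (bglift_linear leps). Qed.
Lemma bgantip_linear : linear bgantip. Proof. exact: (bglift_linear lantip). Qed.

Let lc := bgcop_linear.
Let le := bgeps_linear.
Let la := bgantip_linear.

Lemma bg_mulext (W : lmodType k) (f f' : C -> C -> W) :
  bilin f -> bilin f' ->
  (forall x g y h, f (x ⊗ 'ζ_g) (y ⊗ 'ζ_h) = f' (x ⊗ 'ζ_g) (y ⊗ 'ζ_h)) ->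
  forall s t, f s t = f' s t.
Proof.
move=> [bl br] [bl' br'] E s t; move: s; apply: (bg_ext (bl t) (bl' t)) => x g.
by move: t; apply: (bg_ext (br _) (br' _)) => y h.
Qed.

Lemma mul_bilin (D : algType k) : bilin (fun x y : D => x * y).
Proof.
split=> z a x y /=; first by rewrite mulrDl -scalerAl.
by rewrite mulrDr -scalerAr.
Qed.

Lemma bilin_flip (U V W : lmodType k) (f : U -> V -> W) : bilin f ->
  bilin (fun v u => f u v).
Proof. by case. Qed.

Lemma bilin_post (U V W W' : lmodType k) (f : U -> V -> W) (h : W -> W') :
  bilin f -> linear h -> bilin (fun u v => h (f u v)).
Proof.
by move=> [bl br] lh; split=> z; [exact: linear_comp (bl z) lh | exact: linear_comp (br z) lh].
Qed.

Lemma bg1E : 1 = 1 ⊗ 'ζ_(1%g) :> C.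
Proof. by []. Qed.

Lemma bgcop_monoid : monoid_morphism bgcop.
Proof.
split=> [|s t]; first by rewrite bg1E bgcopE (cop_monoid H).1 m2.1.
move: s t; apply: bg_mulext.
- exact: bilin_post (@mul_bilin _) lc.
- exact: bilin_comp lc lc (@mul_bilin _).
- by move=> x g y h; rewrite pureM gbasisM !bgcopE (cop_monoid H).2 j2M.
Qed.

Lemma bgeps_monoid : monoid_morphism bgeps.
Proof.
split=> [|s t]; first by rewrite bg1E bgepsE (eps_monoid H).1.
move: s t; apply: (@bg_mulext k^o).
- exact: bilin_post (@mul_bilin _) le.
- exact: bilin_comp le le (@mul_bilin k^o).
- by move=> x g y h; rewrite pureM gbasisM !bgepsE (eps_monoid H).2.
Qed.

Lemma bgantip1 : bgantip 1 = 1.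
Proof. by rewrite bg1E bgantipE antip1 invg1. Qed.

Lemma bgantipM s t : bgantip (s * t) = bgantip t * bgantip s.
Proof.
move: s t; apply: bg_mulext.
- exact: bilin_post (@mul_bilin _) la.
- exact/bilin_flip/(bilin_comp la la (@mul_bilin _)).
- by move=> x g y h; rewrite pureM gbasisM !bgantipE antipM pureM gbasisM invgM.
Qed.

Lemma bgPhiK : bgPhi * bgPhi_inv = 1.
Proof. by rewrite -[LHS]m3.2 PhiK m3.1. Qed.

Lemma bgPhiVK : bgPhi_inv * bgPhi = 1.
Proof. by rewrite -[LHS]m3.2 PhiVK m3.1. Qed.

Let jc g x : j2 g (cop H x) = bgcop (bgin g x) := esym (bgcopE x g).
Let je g x : bgeps (bgin g x) = eps H x := bgepsE x g.

Lemma bgpentagon : unit_l bgPhi * cop3_2 bgcop bgPhi * unit_r bgPhi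
             = cop3_3 bgcop bgPhi * cop3_1 bgcop bgPhi.
Proof.
have [N1 N2] := pentagon_nat (lj 1%g) (cop_linear H) lc (jc 1%g) m1.1 m1.2 (Phi H).
by rewrite -[LHS]N1 -[RHS]N2 pentagon.
Qed.

Lemma bgquasi_coassoc s :
  bgPhi * cop_l bgcop (bgcop s) = cop_r bgcop (bgcop s) * bgPhi.
Proof.
move: s; apply: bg_ext.
- exact: linear_comp (linear_comp lc (cop_l_linear lc)) ((@mul_bilin _).2 _).
- exact: linear_comp (linear_comp lc (cop_r_linear lc)) ((@mul_bilin _).1 _).
move=> x g; rewrite bgcopE.
have Nl := cop_l_nat (lj g) (cop_linear H) lc (jc g) (cop H x).
have Nr := cop_r_nat (lj g) (cop_linear H) lc (jc g) (cop H x).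
rewrite -/(j2 g) -/(j3 g) in Nl; rewrite -/(j2 g) -/(j3 g) in Nr.
rewrite -Nl -Nr -[bgPhi]/(j3 1%g (Phi H)) -!j3M quasi_coassoc.
by rewrite mul1g mulg1.
Qed.

Lemma bgPhi_counit : tmap id (tlift (fun b c => bgeps b *: c)) bgPhi = 1 ⊗ 1.
Proof.
have N := Phi_counit_nat (lj 1%g) (eps_linear H) le (je 1%g) (Phi H).
by rewrite -[LHS]N Phi_counit -tens1E; exact: m2.1.
Qed.

Lemma bgcounit_r s : tlift (fun a b => bgeps b *: a) (bgcop s) = s.
Proof.
move: s; apply: bg_ext; [|exact: linear_id|move=> x g].
  exact: linear_comp lc (tlift_is_linear (scale_bilinr le)).
by rewrite bgcopE -(counit_r_nat (lj g) le (je g)) counit_r.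
Qed.

Lemma bgcounit_l s : tlift (fun a b => bgeps a *: b) (bgcop s) = s.
Proof.
move: s; apply: bg_ext; [|exact: linear_id|move=> x g].
  exact: linear_comp lc (tlift_is_linear (scale_bilinl le)).
by rewrite bgcopE -(counit_l_nat (lj g) le (je g)) counit_l.
Qed.

Let lscale (D : lmodType k) (c : D) : linear (fun a : k^o => a *: c).
Proof. by move=> a x y; rewrite scalerDl scalerA. Qed.

Lemma bgantip_alpha s :
  tlift (fun a b => bgantip a * bgalpha * b) (bgcop s) = bgeps s *: bgalpha.
Proof.
move: s; apply: bg_ext => [||x g].
- exact: linear_comp lc (tlift_is_linear (mulSl_bilin _ la)).
- exact: linear_comp le (@lscale _ bgalpha).
rewrite bgcopE /j2 (tlift_tmap _ (lj g) (lj g) (mulSl_bilin _ la)) bgepsE.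
rewrite -(linear_fZ (lj 1%g)) -antip_alpha (tlift_fun _ _ (lj 1%g)).
by apply: tlift_ext => a b; rewrite bgantipE !pureM !gbasisM mulg1 mulVg.
Qed.

Lemma bgantip_beta s :
  tlift (fun a b => a * bgbeta * bgantip b) (bgcop s) = bgeps s *: bgbeta.
Proof.
move: s; apply: bg_ext => [||x g].
- exact: linear_comp lc (tlift_is_linear (mulSr_bilin _ la)).
- exact: linear_comp le (@lscale _ bgbeta).
rewrite bgcopE /j2 (tlift_tmap _ (lj g) (lj g) (mulSr_bilin _ la)) bgepsE.
rewrite -(linear_fZ (lj 1%g)) -antip_beta (tlift_fun _ _ (lj 1%g)).
by apply: tlift_ext => a b; rewrite bgantipE !pureM !gbasisM mulg1 mulgV.
Qed.

Let jS x : bgin 1%g (antip H x) = bgantip (bgin 1%g x).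
Proof. by rewrite [RHS]bgantipE invg1. Qed.

Lemma bgPhi_zigzag :
  tlift3 (fun a b c => a * bgbeta * bgantip b * bgalpha * c) bgPhi = 1.
Proof.
by rewrite -[LHS](zig_nat _ _ (lj 1%g) la jS m1.2) Phi_zigzag m1.1.
Qed.

Lemma bgPhi_inv_zigzag :
  tlift3 (fun a b c => bgantip a * bgalpha * b * bgbeta * bgantip c) bgPhi_inv = 1.
Proof.
by rewrite -[LHS](zag_nat _ _ (lj 1%g) la jS m1.2) Phi_inv_zigzag m1.1.
Qed.

Lemma bgeps_alpha : bgeps bgalpha = 1.
Proof. by rewrite bgepsE eps_alpha. Qed.

Lemma bgeps_beta : bgeps bgbeta = 1.
Proof. by rewrite bgepsE eps_beta. Qed.

Definition group_tensor_qHopf : quasiHopf C :=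
  QuasiHopf bgcop_linear bgcop_monoid bgeps_linear bgeps_monoid bgPhiK bgPhiVK
    bgantip_linear bgantip1 bgantipM bgpentagon bgquasi_coassoc bgPhi_counit
    bgcounit_r bgcounit_l bgantip_alpha bgantip_beta bgPhi_zigzag
    bgPhi_inv_zigzag bgeps_alpha bgeps_beta.

Definition bgcomp (g : Γ) : set C := fun t => exists x, t = x ⊗ 'ζ_g.

Definition bgcoef (g : Γ) : C -> B := bglift (fun x (h : Γ) => x *+ (h == g)).

Let lcoef g : forall h : Γ, linear (fun x : B => x *+ (h == g)).
Proof. by move=> h a x y; rewrite mulrnDl scalerMnr. Qed.

Lemma bgcoefE g x h : bgcoef g (x ⊗ 'ζ_h) = x *+ (h == g).
Proof. exact: (bgliftE (lcoef g)). Qed.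

Lemma bgcoef_linear g : linear (bgcoef g).
Proof. exact: (bglift_linear (lcoef g)). Qed.

Lemma bgcomp0 g : bgcomp g 0.
Proof. by exists 0; rewrite pure0l. Qed.

Lemma bgcomp_linear g a x y : bgcomp g x -> bgcomp g y -> bgcomp g (a *: x + y).
Proof.
by move=> [b ->] [c ->]; exists (a *: b + c); rewrite pureDl pureZl.
Qed.

Lemma bgcomp_direct t : exists! z : {malg C[Γ]},
  (forall g, bgcomp g z@_g) /\ t = \sum_(g <- msupp z) z@_g.
Proof.
have [z [zP zE]] : exists z : {malg C[Γ]}, (forall g, bgcomp g z@_g) /\ t = hsum z.
  elim/bg_ind: t => [|s t [z [zP zE]] [z' [zP' zE']]|x g].
  - by exists 0; split=> [g|]; rewrite ?hsum0 // mcoeff0; exact: bgcomp0.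
  - exists (1 *: z + z'); split; last by rewrite hsum_linear mul1r zE zE'.
    move=> g; rewrite mcoeffD scale1r -[z@_g]scale1r; exact: bgcomp_linear.
  - exists (mkmalgU g (x ⊗ 'ζ_g)); split; last by rewrite hsumU.
    move=> h; rewrite mcoeffU; case: eqP => [<-|_]; last exact: bgcomp0.
    by exists x.
exists z; split=> // z' [zP' zE']; apply/malgP => h.
have K (w : {malg C[Γ]}) : (forall g, bgcomp g w@_g) ->
    w@_h = bgcoef h (hsum w) ⊗ 'ζ_h.
  move=> wP; rewrite /hsum.
  have -> : bgcoef h (\sum_(g <- msupp w) w@_g) = bgcoef h w@_h.
    have l := bgcoef_linear h.
    have E : bgcoef h (\sum_(g <- msupp w) w@_g) =
              \sum_(g <- msupp w) bgcoef h w@_g *+ (g == h).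
      elim: (enum_fset _) => [|g s IH]; first by rewrite !big_nil (linear_f0 l).
      rewrite !big_cons (linear_fD l) IH; congr (_ + _).
      by have [x ->] := wP g; rewrite bgcoefE; case: eqP.
    rewrite E; have [hw|hw] := boolP (h \in msupp w).
      rewrite (big_fsetD1 h) //= eqxx big1_fset ?addr0 // => g.
      by rewrite in_fsetD1 => /andP[/negPf-> _].
    rewrite mcoeff_outdom // (linear_f0 l) big1_fset // => g gw _.
    by case: eqP => // E'; rewrite E' (negPf hw) in gw.
  by have [x ->] := wP h; rewrite bgcoefE eqxx.
by rewrite K // [RHS]K // -zE [hsum z']/hsum -zE'.
Qed.

Lemma bgcompM g h x y : bgcomp g x -> bgcomp h y -> bgcomp (g * h)%g (x * y).
Proof. by move=> [b ->] [c ->]; exists (b * c); rewrite pureM gbasisM. Qed.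

Lemma tens_sub_image (U U' V V' : lmodType k) (f : U -> U') (f' : V -> V')
    (P : set U') (Q : set V') (t : (U ⊗ V)%type) : linear f -> linear f' ->
  (forall x, P (f x)) -> (forall x, Q (f' x)) -> tens_sub P Q (tmap f f' t).
Proof.
move=> lf lf' fP fQ; exists [seq (f p.1, f' p.2) | p <- repr t]; split.
  by move=> _ /mapP[p _ ->]; split; [exact: fP|exact: fQ].
by rewrite big_map.
Qed.

Lemma bgcomp_cop g t : bgcomp g t -> tens_sub (bgcomp g) (bgcomp g) (bgcop t).
Proof. move=> [x ->]; rewrite bgcopE.
by apply: (tens_sub_image _ (lj g) (lj g)) => y; exists y. Qed.

Lemma bgcomp_antip g t : bgcomp g t -> bgcomp g^-1%g (bgantip t).
Proof. by move=> [x ->]; exists (antip H x); rewrite bgantipE. Qed.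

Lemma bgcomp_Phi :
  tens_sub (bgcomp 1%g) (tens_sub (bgcomp 1%g) (bgcomp 1%g)) bgPhi.
Proof.
apply: (tens_sub_image _ (lj _) (lj2 _)) => x; first by exists x.
by apply: (tens_sub_image _ (lj _) (lj _)) => y; exists y.
Qed.

Lemma bgcomp_alpha : bgcomp 1%g bgalpha. Proof. by exists (qalpha H). Qed.
Lemma bgcomp_beta : bgcomp 1%g bgbeta. Proof. by exists (qbeta H). Qed.

Definition group_tensor : gradedQHopf Γ C :=
  @GradedQHopf k Γ C group_tensor_qHopf bgcomp bgcomp0 bgcomp_linear
    bgcomp_direct bgcompM bgcomp_cop bgcomp_antip bgcomp_Phi bgcomp_alpha
    bgcomp_beta.

End GroupTensor.

Section Splittings.
Variables (k : fieldType) (Γ : groupType) (A : algType k).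
Variable G : gradedQHopf Γ A.

Definition neutral_retraction (τ : A -> neutral G) : Prop :=
  qHopf_morphism G (neutral_qHopf G) τ /\ forall b : neutral G, τ (nval b) = b.

Definition augmented_complement (L : set A) : Prop :=
  [/\ qHopf_ideal G L, augmented G L & (L `&` hcomp G 1%g = [set 0])%classic].

Definition central_group_likes (u : Γ -> A) : Prop :=
  [/\ forall g, hcomp G g (u g),
      forall g, group_like G (u g) /\ is_unit (u g),
      forall g h, u g * u h = u (g * h)%g
    & forall g b, hcomp G 1%g b -> u g * b = b * u g].

Definition splitting_linked (τ : A -> neutral G) (L : set A) (u : Γ -> A) : Prop :=
  (L = [set x | τ x = 0])%classic /\ forall g, τ (u g) = 1.

End Splittings.

(* Main.v *)
(* Counitality gives x in A_g with ε(x) = 1, so α = S(x')αx'' lies in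
   A_(g^-1) A_g; since the zigzag identity exhibits 1 in A_e α A_e, a faithful
   grading is strong: A_(g^-1) A_g = A_e. Hence a retraction τ restricts to
   bijections A_g -> A_e, and u_g is the preimage of 1. Conversely τ is
   x_g |-> x_g u_g^-1.

   Let L be an augmented complement. The same use of α shows that a nonzero
   ideal of A_e obtained from the elements of L supported in a finite set
   contains 1. Contracting the coproduct of such an element against functionals
   killing L, as in the proof that group-likes are linearly independent, shows
   that distinct images of the A_g in A/L are independent. Therefore, if T is
   the subgroup of those t with 1 in A_t + L, the linear form on k[Γ] that is
   the indicator function of T vanishes on π(L); as π(L) is the whole
   augmentation ideal, T = Γ, so A = A_e + L and τ is the projection along L. *)
Require Import Defs.
From mathcomp Require Import all_boot all_order all_algebra finmap.
From mathcomp Require Import boolp classical_sets.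
From mathcomp Require Import monalg.

Set Implicit Arguments.
Unset Strict Implicit.
Unset Printing Implicit Defensive.

Import GRing.Theory.
Local Open Scope ring_scope.

(** * Linear algebra: complements of subspaces and separating functionals *)

Lemma linear_fN (k : fieldType) (U V : lmodType k) (f : U -> V) :
  linear f -> {morph f : x / - x}.
Proof. by move=> lf x; rewrite -scaleN1r (linear_fZ lf) scaleN1r. Qed.

Lemma linear_fB (k : fieldType) (U V : lmodType k) (f : U -> V) :
  linear f -> {morph f : x y / x - y}.
Proof. by move=> lf x y; rewrite (linear_fD lf) (linear_fN lf). Qed.

Lemma linear_fsum (k : fieldType) (U V : lmodType k) (f : U -> V)
    (I : Type) (s : seq I) (F : I -> U) :
  linear f -> f (\sum_(i <- s) F i) = \sum_(i <- s) f (F i).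
Proof. by move=> lf; apply: big_morph; [exact: linear_fD | exact: linear_f0]. Qed.

Section LinearRetraction.
Variables (k : fieldType) (V : lmodType k).

Definition subspace (P : set V) : Prop :=
  P 0 /\ forall a x y, P x -> P y -> P (a *: x + y).

Section Ops.
Variables (P : set V) (sP : subspace P).

Lemma subspaceZ a x : P x -> P (a *: x).
Proof. by move=> Px; rewrite -[_ *: _]addr0; apply: sP.2 => //; exact: sP.1. Qed.

Lemma subspaceD x y : P x -> P y -> P (x + y).
Proof. by move=> Px Py; rewrite -[x]scale1r; exact: sP.2. Qed.

Lemma subspaceN x : P x -> P (- x).
Proof. by move=> Px; rewrite -scaleN1r; exact: subspaceZ. Qed.

Lemma subspaceB x y : P x -> P y -> P (x - y).
Proof. by move=> Px /subspaceN; exact: subspaceD. Qed.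

Lemma subspace_sum (I : Type) (s : seq I) (F : I -> V) :
  (forall i, P (F i)) -> P (\sum_(i <- s) F i).
Proof. by move=> PF; elim/big_ind: _ => //; [exact: sP.1 | exact: subspaceD]. Qed.

End Ops.

(** Zorn's lemma gives a maximal [W] for which L ∪ W is a subspace meeting P only in 0; this union
    is a complement of P, and [r] projects along it. Taking the union with [L] makes the empty chain
    admissible. *)
Lemma exists_linear_retraction (P L : set V) : subspace P -> subspace L ->
  (forall x, P x -> L x -> x = 0) ->
  exists r : V -> V, [/\ linear r, forall x, P (r x),
    forall x, P x -> r x = x & forall x, L x -> r x = 0].
Proof.
move=> sP sL PL0.
pose Q (W : set V) :=
  subspace (L `|` W)%classic /\ forall x, P x -> W x -> x = 0.
have [|W [[sM WP] Wmax]] := @Zorn_bigcup V Q.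
  move=> F FQ tot; split; last by move=> x Px [X FX Xx]; exact: (FQ _ FX).2 Xx.
  have FL X a x y : F X -> (L `|` X)%classic x -> (L `|` X)%classic y ->
      (L `|` \bigcup_(X in F) X)%classic (a *: x + y).
    move=> FX Xx Xy.
    by have [|Z] := (FQ _ FX).1.2 a x y Xx Xy; [left | right; exists X].
  split; first by left; exact: sL.1.
  move=> a x y [Lx|[X FX Xx]] [Ly|[Y FY Yy]].
  - by left; apply: sL.2.
  - by apply: (FL Y) => //; [left | right].
  - by apply: (FL X) => //; [right | left].
  - have [XY|YX] := tot _ _ FX FY.
      by apply: (FL Y) => //; right => //; exact: XY.
    by apply: (FL X) => //; right => //; exact: YX.
pose M := (L `|` W)%classic.
have MP x : P x -> M x -> x = 0 by move=> Px [/PL0->|/WP->].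
have ex x : exists p, P p /\ M (x - p).
  (* If x were outside P + M, the larger subspace M + kx would still meet P only in 0, against
     maximality. *)
  apply: contrapT => nex.
  pose W' := [set y | exists m a, M m /\ y = m + a *: x]%classic.
  have MW' : (M `<=` W')%classic by move=> m Mm; exists m, 0; rewrite scale0r addr0.
  have LW' : (L `|` W' = W')%classic.
    by apply/seteqP; split=> y; [case=> // Ly; apply: MW'; left | right].
  apply: (Wmax W').
    split; first by move=> y Wy; apply: MW'; right.
    move=> sub; apply: nex; exists 0; split; first exact: sP.1.
    rewrite subr0; right; apply: sub; exists 0, 1; split; first exact: sM.1.
    by rewrite scale1r add0r.
  split.
    rewrite LW'; split; first by apply: MW'; exact: sM.1.
    move=> a _ _ [m [b [Mm ->]]] [n [c [Mn ->]]].
    exists (a *: m + n), (a * b + c); split; first exact: sM.2.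
    by rewrite scalerDr scalerA addrACA -scalerDl.
  move=> y Py [m [a [Mm yE]]]; have [a0|a0] := eqVneq a 0.
    by apply: MP => //; rewrite yE a0 scale0r addr0.
  case: nex; exists (a^-1 *: y); split; first exact: subspaceZ.
  rewrite yE scalerDr scalerA mulVf // scale1r opprD addrCA subrr addr0 -scalerN.
  by apply: (subspaceZ sM); exact: (subspaceN sM).
have uniq x p q : P p -> P q -> M (x - p) -> M (x - q) -> p = q.
  move=> Pp Pq Mp Mq; apply/eqP; rewrite -subr_eq0; apply/eqP/MP.
    exact: subspaceB.
  by have := subspaceB sM Mq Mp; rewrite opprB addrC addrA subrK.
pose r x := projT1 (cid (ex x)).
have rP x : P (r x) /\ M (x - r x) by exact: projT2 (cid (ex x)).
exists r; split=> [a x y|x|x Px|x Lx].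
- apply: (uniq (a *: x + y)); [exact: (rP _).1 | | exact: (rP _).2 |].
    by apply: sP.2; exact: (rP _).1.
  rewrite opprD addrACA -scalerBr; apply: sM.2; exact: (rP _).2.
- exact: (rP x).1.
- by apply: (uniq x) (rP x).1 Px (rP x).2 _; rewrite subrr; exact: sM.1.
- by apply: (uniq x) (rP x).1 sP.1 (rP x).2 _; rewrite subr0; left.
Qed.

(** The line through [v] meets L only in 0; retract onto it along L and apply a form with value 1 at
    [v]. *)
Lemma separating_form (L : set V) (v : V) : subspace L -> ~ L v ->
  exists f : V -> k^o, [/\ linear f, f v = 1 & forall x, L x -> f x = 0].
Proof.
move=> sL nLv; pose P := [set x | exists c, x = c *: v]%classic.
have v0 : v != 0 by apply/eqP => v0; apply: nLv; rewrite v0; exact: sL.1.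
have [|x [c ->] Lc|r [lr _ rP rL]] := @exists_linear_retraction P L _ sL.
- split; first by exists 0; rewrite scale0r.
  by move=> a _ _ [b ->] [c ->]; exists (a * b + c); rewrite scalerDl scalerA.
- have [->|c0] := eqVneq c 0; first by rewrite scale0r.
  by case: nLv; have := subspaceZ sL c^-1 Lc; rewrite scalerA mulVf // scale1r.
have [f lf fv] := exists_linear_form v0.
exists (fun x => f (r x)); split=> [||x Lx]; first exact: linear_comp lr lf.
  by rewrite rP //; exists 1; rewrite scale1r.
by rewrite rL // (linear_f0 lf).
Qed.

End LinearRetraction.

(** * Linear maps on graded spaces, and strength of faithful gradings *)

Section GradedGluing.
Variables (k : fieldType) (Γ : groupType) (A : algType k).
Variable G : gradedQHopf Γ A.

Lemma hcomp_subspace g : subspace (hcomp G g).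
Proof. by split; [exact: hcomp0 | exact: hcomp_linear]. Qed.

Definition hlift (W : lmodType k) (φ : Γ -> A -> W) (x : A) : W :=
  \sum_(g <- msupp (hdecomp G x)) φ g (hproj G g x).

Section HLift.
Variables (W : lmodType k) (φ : Γ -> A -> W).
Hypothesis lφ : forall g, linear (φ g).

Lemma hlift_sub x (d : {fset Γ}) : (msupp (hdecomp G x) `<=` d)%fset ->
  hlift φ x = \sum_(g <- d) φ g (hproj G g x).
Proof.
move=> le_d; rewrite /hlift (big_fset_incl _ le_d) //= => g _ /mcoeff_outdom E.
by rewrite /hproj E (linear_f0 (lφ g)).
Qed.

Lemma hlift_linear : linear (hlift φ).
Proof.
move=> a x y; pose s z := msupp (hdecomp G z).
(* A common index set for the three sums; the added terms vanish. *)
pose d := (s (a *: x + y)%R `|` (s x `|` s y))%fset.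
rewrite !(@hlift_sub _ d) /d ?fsubsetUl //.
- rewrite scaler_sumr -big_split; apply: eq_bigr => g _ /=.
  by rewrite hproj_linear lφ.
- by rewrite fsubsetU // fsubsetUr orbT.
- by rewrite fsubsetU // fsubsetUl orbT.
Qed.

Lemma hliftE g x : hcomp G g x -> hlift φ x = φ g x.
Proof.
move=> gx; pose d := (msupp (hdecomp G x) `|` [fset g])%fset.
rewrite (@hlift_sub _ d) ?fsubsetUl // (big_fsetD1 g) ?in_fsetU ?in_fset1 ?eqxx ?orbT //=.
rewrite hproj_id // big1_fset ?addr0 // => h; rewrite in_fsetD1 => /andP[hg _] _.
by rewrite (hprojE _ gx) eq_sym (negPf hg) (linear_f0 (lφ h)).
Qed.

End HLift.

Lemma homogeneous_ext (W : lmodType k) (f f' : A -> W) :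
  linear f -> linear f' -> (forall g x, hcomp G g x -> f x = f' x) -> f =1 f'.
Proof.
move=> lf lf' ff x; rewrite (hsum_hproj G x) !linear_fsum //.
by apply: eq_bigr => g _; apply: ff (hproj_mem _ _ _).
Qed.

Lemma grading_map_linear : linear (grading_map G).
Proof.
apply: (@hlift_linear _ (fun g x => eps G x *: 'ζ_g)) => g a x y.
by rewrite (eps_linear G) scalerDl scalerA.
Qed.

Lemma hproj_graded (f : A -> A) g x : linear f ->
  (forall h y, hcomp G h y -> hcomp G h (f y)) ->
  hproj G g (f x) = f (hproj G g x).
Proof.
move=> lf fP; move: x; apply: homogeneous_ext => [||h x hx].
- exact: linear_comp lf (hproj_linear G g).
- exact: linear_comp (hproj_linear G g) lf.
- rewrite (hprojE _ hx) (hprojE _ (fP _ _ hx)).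
  by case: eqP => // _; rewrite mulr0n (linear_f0 lf).
Qed.

Lemma hproj_mulr g h a x : hcomp G h a ->
  hproj G (g * h)%g (x * a) = hproj G g x * a.
Proof.
move=> ha; have la : linear (fun y : A => y * a).
  by move=> c y z; rewrite mulrDl scalerAl.
move: x; apply: homogeneous_ext => [||l x lx].
- exact: linear_comp la (hproj_linear G _).
- exact: linear_comp (hproj_linear G g) la.
- rewrite (hprojE _ lx) (hprojE _ (hcompM lx ha)) (inj_eq (mulIg h)).
  by case: eqP => // _; rewrite mulr0n mul0r.
Qed.

Lemma hproj_eq0 x : (forall g, hproj G g x = 0) -> x = 0.
Proof. by move=> x0; rewrite (hsum_hproj G x) big1. Qed.

Lemma hcompM1l g a x : hcomp G 1%g a -> hcomp G g x -> hcomp G g (a * x).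
Proof. by move=> a1 gx; rewrite -[g]mul1g; exact: hcompM. Qed.

Lemma hcompM1r g a x : hcomp G 1%g a -> hcomp G g x -> hcomp G g (x * a).
Proof. by move=> a1 gx; rewrite -[g]mulg1; exact: hcompM. Qed.

Lemma hcompMV g x y : hcomp G g x -> hcomp G g^-1%g y -> hcomp G 1%g (x * y).
Proof. by move=> gx gy; rewrite -(mulgV g); exact: hcompM. Qed.

Lemma hcompVM g x y : hcomp G g^-1%g x -> hcomp G g y -> hcomp G 1%g (x * y).
Proof. by move=> gx gy; rewrite -(mulVg g); exact: hcompM. Qed.

Lemma antip_hcomp1 x : hcomp G 1%g x -> hcomp G 1%g (antip G x).
Proof. by move/(hcomp_antip); rewrite invg1. Qed.

(** The legs of Φ^-1 are taken in A_e, so that each factor has degree e and commutes with central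
    group-likes. *)
Lemma zag_neutral :
  tlift3 (fun a b c : neutral G => antip G (nval a) * qalpha G * nval b *
     qbeta G * antip G (nval c)) (nPhi_inv G) = 1.
Proof.
rewrite -(tlift3_tmap _ (@nval_linear _ _ _ G) (zag_trilin _ _ (antip_linear G))).
by rewrite nval_Phi_inv Phi_inv_zigzag.
Qed.

(* An ideal of A_e containing α is A_e, by the zigzag identity for Φ^-1. *)
Lemma ideal_alpha1 (R : A -> Prop) : R 0 -> (forall x y, R x -> R y -> R (x + y)) ->
  (forall a c, hcomp G 1%g a -> hcomp G 1%g c -> R (a * qalpha G * c)) -> R 1.
Proof.
move=> R0 RD RM; rewrite -zag_neutral /tlift3 /tlift.
elim/big_ind: _ => // p _; elim/big_ind: _ => // q _.
rewrite -!mulrA [X in R X]mulrA; apply: RM; first exact/antip_hcomp1/nval_hcomp.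
apply: hcompM1l (nval_hcomp _) _; apply: hcompM1l (hcomp_beta G) _.
exact/antip_hcomp1/nval_hcomp.
Qed.

Hypothesis G_faithful : faithfully_graded G.

(** If ε vanished on A_g, then x = ε(x')x'' with x' in A_g would force A_g = 0. *)
Lemma faithful_eps1 g : exists2 x, hcomp G g x & eps G x = 1.
Proof.
have [x [gx x0]] := G_faithful g; apply: contrapT => no.
have e0 y : hcomp G g y -> eps G y = 0.
  move=> gy; have [//|ey] := eqVneq (eps G y) 0; case: no.
  exists ((eps G y)^-1 *: y); first exact: hcompZ.
  by rewrite (linear_fZ (eps_linear G)) /= [LHS]mulVf.
apply: x0; rewrite -(counit_l G x).
move: (cop G x) (hcomp_cop gx); apply: tens_sub_ind => [|s t Hs Ht|u v gu gv].
- by rewrite (linear_f0 (tlift_is_linear (scale_bilinl (eps_linear G)))).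
- by rewrite (linear_fD (tlift_is_linear (scale_bilinl (eps_linear G)))) Hs Ht addr0.
- by rewrite (tliftE (scale_bilinl (eps_linear G))) e0 // scale0r.
Qed.

(* A_(g^-1) A_g = A_e: pick x in A_g with ε(x) = 1, so that α = S(x')αx''
   lies in the ideal A_(g^-1) A_g of A_e. *)
Lemma strong_grading g (R : A -> Prop) :
  R 0 -> (forall x y, R x -> R y -> R (x + y)) ->
  (forall y x, hcomp G g^-1%g y -> hcomp G g x -> R (y * x)) -> R 1.
Proof.
move=> R0 RD RM; apply: ideal_alpha1 => // a c ha hc.
have [x gx ex] := faithful_eps1 g.
have bS := mulSl_bilin (qalpha G) (antip_linear G).
have lS := tlift_is_linear bS.
rewrite -[qalpha G]scale1r -ex -antip_alpha.
move: (cop G x) (hcomp_cop gx); apply: tens_sub_ind => [|s t Hs Ht|u v gu gv].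
- by rewrite (linear_f0 lS) mulr0 mul0r.
- by rewrite (linear_fD lS) mulrDr mulrDl; exact: RD.
- rewrite (tliftE bS) mulrA -mulrA; apply: RM; last exact: hcompM1r.
  apply: hcompM1l => //; apply: hcompM1r (hcomp_alpha G) _.
  exact: hcomp_antip.
Qed.

Lemma strong_gradingV g (R : A -> Prop) :
  R 0 -> (forall x y, R x -> R y -> R (x + y)) ->
  (forall x y, hcomp G g x -> hcomp G g^-1%g y -> R (x * y)) -> R 1.
Proof.
move=> R0 RD RM; apply: (@strong_grading g^-1%g) => // x y.
by rewrite invgK; exact: RM.
Qed.

(** An [x] killing A_g on the right also kills A_g A_(g^-1), which contains 1. *)
Lemma homogeneous_regular g x : x <> 0 ->
  exists2 a, hcomp G g a & x * a <> 0.
Proof.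
move=> x0; apply: contrapT => no; apply: x0; rewrite -[x]mulr1.
apply: (@strong_gradingV g (fun b => x * b = 0)) => [|a b Ha Hb|a b ga gb].
- by rewrite mulr0.
- by rewrite mulrDr Ha Hb addr0.
- rewrite mulrA; have [->|/eqP xa] := eqVneq (x * a) 0; first exact: mul0r.
  by case: no; exists a.
Qed.

End GradedGluing.

(** * From a retraction to its kernel and to group-like units *)

Lemma tmap_pureMr (k : fieldType) (U : lmodType k) (A : algType k)
    (f : U -> A) (u : A) (t : (U ⊗ U)%type) : linear f ->
  tmap (fun x => f x * u) (fun x => f x * u) t = tmap f f t * (u ⊗ u).
Proof.
move=> lf; have lu : linear (fun y : A => y * u).
  by move=> c y z; rewrite mulrDl scalerAl.
have lfu := linear_comp lf lu.
move: t; apply: tens_ext => [||x y].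
- exact: (tmap_linear lfu lfu).
- exact: linear_comp (tmap_linear lf lf) (@tmul_linearl _ _ _ (u ⊗ u)).
- by rewrite !tmapE // pureM.
Qed.

(** This is id⊗id - p⊗p = (id - p)⊗id + p⊗(id - p). For [p] a projection with kernel L, it puts Δ(x)
    into L⊗A + A⊗L. *)
Lemma tmap_sub_fixed (k : fieldType) (A : algType k) (p : A -> A) (t : (A ⊗ A)%type) : linear p ->
  tmap p p t = 0 ->
  t = tmap (fun x => x - p x) id t + tmap p (fun x => x - p x) t.
Proof.
move=> lp pp0; rewrite -[LHS]subr0 -[X in _ - X]pp0 {pp0}.
have lq : linear (fun x => x - p x).
  by move=> a x y; rewrite lp opprD addrACA -scalerN -scalerDr.
have li := @linear_id k A.
move: t; apply: tens_ext => [a x y|a x y|x y].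
- by rewrite (tmap_linear lp lp) opprD addrACA -scalerN -scalerDr.
- by rewrite (tmap_linear lq li) (tmap_linear lp lq) addrACA -scalerDr.
- rewrite !tmapE // -[- p x]scaleN1r -[- p y]scaleN1r !(pureDl, pureDr, pureZl, pureZr).
  by rewrite !scaleN1r addrA subrK.
Qed.

Section RetractionSplitting.
Variables (k : fieldType) (Γ : groupType) (A : algType k).
Variable G : gradedQHopf Γ A.
Local Notation nv := (@nval _ _ _ G).
Variable τ : A -> neutral G.
Hypothesis rτ : neutral_retraction τ.

Let lτ : linear τ := qm_linear rτ.1.
Let mτ : monoid_morphism τ := qm_monoid rτ.1.
Let lv : linear nv := @nval_linear _ _ _ G.

Lemma retractionK b : hcomp G 1%g b -> nv (τ b) = b.
Proof. by move=> /nprojK <-; rewrite rτ.2. Qed.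

Lemma kernel_qHopf_ideal : qHopf_ideal G [set x | τ x = 0]%classic.
Proof.
split=> /=.
- exact: linear_f0 lτ.
- by move=> a x y x0 y0; rewrite lτ x0 y0 scaler0 addr0.
- by move=> a x x0; rewrite mτ.2 x0 mulr0.
- by move=> a x x0; rewrite mτ.2 x0 mul0r.
- move=> x x0; pose p y := nv (τ y).
  have lp : linear p := linear_comp lτ lv.
  have lq : linear (fun x => x - p x).
    by move=> a y z; rewrite lp opprD addrACA -scalerN -scalerDr.
  have τp y : τ (y - p y) = 0 by rewrite (linear_fB lτ) rτ.2 subrr.
  exists (tmap (fun x => x - p x) id (cop G x)).
  exists (tmap p (fun x => x - p x) (cop G x)); split.
  + by apply: tens_sub_image lq (@linear_id k A) _ _ => // y; exact: τp.
  + by apply: tens_sub_image lp lq _ _ => // y; exact: τp.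
  (* (p⊗p)Δ(x) is the image in A⊗A of Δ(τ(x)) = 0. *)
  + apply: tmap_sub_fixed => //; rewrite /p -(tmap_comp _ lτ lv lτ lv).
    rewrite -(qm_cop rτ.1) x0 (linear_f0 (cop_linear (neutral_qHopf G))).
    exact: (linear_f0 (tmap_linear lv lv)).
- by move=> x x0; rewrite -(qm_eps rτ.1) x0 (linear_f0 (eps_linear (neutral_qHopf G))).
- by move=> x x0; rewrite -(qm_antip rτ.1) x0 (linear_f0 (antip_linear (neutral_qHopf G))).
Qed.

Hypothesis G_faithful : faithfully_graded G.

Lemma retraction_unit g : exists2 u, hcomp G g u & τ u = 1.
Proof.
have [x [gx xE]] : exists x, hcomp G g x /\ τ x = τ 1.
  apply: (@strong_grading _ _ _ _ G_faithful g
    (fun b => exists x, hcomp G g x /\ τ x = τ b)).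
  - by exists 0; split=> //; exact: hcomp0.
  - move=> x y [x' [gx xE]] [y' [gy yE]]; exists (x' + y').
    by rewrite !(linear_fD lτ) xE yE; split=> //; exact: hcompD.
  (* Replacing y by τ(y), which has degree e, moves the product into A_g without changing its image
     under τ. *)
  - move=> y x _ gx; exists (nv (τ y) * x); split.
      by apply: hcompM1l => //; exact: nval_hcomp.
    by rewrite !mτ.2 rτ.2.
by exists x => //; rewrite xE mτ.1.
Qed.

(** For b in A_(g^-1) the product bx lies in A_e, where τ is the identity, so bx = τ(b)τ(x) = 0. Now
    write 1 as a sum of products ab with a in A_g. *)
Lemma retraction_inj g x : hcomp G g x -> τ x = 0 -> x = 0.
Proof.
move=> gx x0; rewrite -[x]mul1r.
apply: (@strong_gradingV _ _ _ _ G_faithful g (fun b => b * x = 0)).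
- by rewrite mul0r.
- by move=> a b Ha Hb; rewrite mulrDl Ha Hb addr0.
- move=> a b _ gb; rewrite -mulrA -(retractionK (hcompVM gb gx)).
  by rewrite mτ.2 x0 !mulr0.
Qed.

Lemma retraction_eq g x y : hcomp G g x -> hcomp G g y -> τ x = τ y -> x = y.
Proof.
move=> gx gy xy; apply/eqP; rewrite -subr_eq0; apply/eqP.
apply: (@retraction_inj g); last by rewrite (linear_fB lτ) xy subrr.
exact: subspaceB (hcomp_subspace G g) _ _ gx gy.
Qed.

Lemma retraction_scale g u x : hcomp G g u -> τ u = 1 -> hcomp G g x ->
  x = nv (τ x) * u.
Proof.
move=> gu u1 gx; apply: (retraction_eq gx).
  by apply: hcompM1l => //; exact: nval_hcomp.
by rewrite mτ.2 rτ.2 u1 mulr1.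
Qed.

(** Both legs of Δ(u) lie in A_g, where a = τ(a)u. Hence Δ(u) = (τ⊗τ)(Δ(u)) (u⊗u) = Δ(τ(u)) (u⊗u) =
    u⊗u. *)
Lemma retraction_group_like g u : hcomp G g u -> τ u = 1 -> group_like G u.
Proof.
move=> gu u1; split; last by rewrite -(qm_eps rτ.1) u1 (eps_monoid (neutral_qHopf G)).1.
have E : cop G u = tmap nv nv (tmap τ τ (cop G u)) * (u ⊗ u).
  rewrite (tmap_comp _ lτ lv lτ lv) -tmap_pureMr; last exact: linear_comp lτ lv.
  apply/esym; apply: (tens_sub_tmap _ _ _ _ (hcomp_cop gu)).
  1,2: by move=> a x y; rewrite lτ lv mulrDl scalerAl.
  1,2: by move=> x gx; rewrite -(retraction_scale gu u1 gx).
rewrite E -(qm_cop rτ.1) u1 (cop_monoid (neutral_qHopf G)).1.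
by rewrite (tmap_monoid lv lv (nval_monoid G) (nval_monoid G)).1 mul1r.
Qed.

(** Every relation compares two elements of the same degree with the same image under τ, which is
    injective on each component. *)
Lemma retraction_central_group_likes :
  exists2 u, central_group_likes G u & forall g, τ (u g) = 1.
Proof.
pose u g := sval (cid2 (retraction_unit g)).
have gu g : hcomp G g (u g) by rewrite /u; case: cid2.
have u1 g : τ (u g) = 1 by rewrite /u; case: cid2.
have uM g h : u g * u h = u (g * h)%g.
  by apply: (retraction_eq (hcompM (gu g) (gu h))) => //; rewrite mτ.2 !u1 mulr1.
have ue : u 1%g = 1 by apply: (retraction_eq (gu _) (hcomp1 G)); rewrite u1 mτ.1.
exists u => //; split=> // [g|g b b1].
  split; first exact: retraction_group_like.
  by exists (u g^-1%g); rewrite !uM mulgV mulVg ue.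
apply: (@retraction_eq g); [exact: hcompM1r | exact: hcompM1l |].
by rewrite !mτ.2 u1 mulr1 mul1r.
Qed.

Lemma retraction_group_likes_uniq u u' :
  central_group_likes G u -> central_group_likes G u' ->
  (forall g, τ (u g) = 1) -> (forall g, τ (u' g) = 1) -> u = u'.
Proof.
move=> [gu _ _ _] [gu' _ _ _] u1 u1'; apply/funext => g.
by apply: (retraction_eq (gu g)) => //; rewrite u1 u1'.
Qed.

Lemma kernel_augmented : augmented G [set x | τ x = 0]%classic.
Proof.
have [u [gu gl _ _] u1] := retraction_central_group_likes.
apply/seteqP; split=> [_ [x /= x0 <-]|_ [s ->]].
  (* Σ ε(x_g) = ε(x) = ε(τ(x)) = 0, so a zero multiple of ζ_e may be subtracted from π(x), giving Σ
     ε(x_g)(ζ_g - ζ_e). *)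
  have e0 : \sum_(g <- msupp (hdecomp G x)) eps G (hproj G g x) = 0.
    rewrite -(linear_fsum _ _ (eps_linear G)) -hsum_hproj -(qm_eps rτ.1) x0.
    exact: linear_f0 (eps_linear (neutral_qHopf G)).
  exists [seq (eps G (hproj G g x), g) | g <- msupp (hdecomp G x)].
  rewrite big_map /grading_map -[LHS]subr0 -[X in _ - X](scale0r 'ζ_(1%g)) -e0.
  rewrite scaler_suml -sumrB; apply: eq_bigr => g _.
  by rewrite scalerBr.
have lπ := grading_map_linear G.
(* π sends u_g - 1 to ζ_g - ζ_e, and τ sends it to 0. *)
exists (\sum_(p <- s) p.1 *: (u p.2 - 1)) => /=.
  rewrite (linear_fsum _ _ lτ) big1 // => p _.
  by rewrite (linear_fZ lτ) (linear_fB lτ) u1 mτ.1 subrr scaler0.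
rewrite (linear_fsum _ _ lπ); apply: eq_bigr => p _.
rewrite (linear_fZ lπ) (linear_fB lπ) (grading_mapE (gu _)) (grading_mapE (hcomp1 G)).
by rewrite (gl _).1.2 (eps_monoid G).1 !scale1r.
Qed.

Lemma kernel_augmented_complement :
  augmented_complement G [set x | τ x = 0]%classic.
Proof.
split; [exact: kernel_qHopf_ideal | exact: kernel_augmented |].
apply/seteqP; split=> [x [/= x0 /retractionK <-]|_ ->].
  by rewrite x0.
by split=> /=; [exact: linear_f0 lτ | exact: hcomp0].
Qed.

(** On A_g, τ(x) = τ(x u_g^-1) = x u_g^-1, the last product having degree e. Thus the family [u]
    determines τ. *)
Lemma retraction_group_likesE u x : central_group_likes G u ->
  (forall g, τ (u g) = 1) -> τ x = hlift G (fun g y => nproj G (y * u g^-1%g)) x.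
Proof.
move=> [gu gl uM _] u1.
have lφ g : linear (fun y => nproj G (y * u g)).
  move=> a y z; rewrite mulrDl -scalerAl; exact: nproj_linear.
move: x; apply: (@homogeneous_ext _ _ _ G) => [//||g x gx].
  by apply: hlift_linear => g; exact: lφ.
rewrite (hliftE _ gx) => [|h]; last exact: lφ.
apply: nval_inj; rewrite nprojK; last exact: hcompMV gx (gu _).
by rewrite -[RHS](retractionK (hcompMV gx (gu _))) mτ.2 u1 mulr1.
Qed.

End RetractionSplitting.

(** x - τ(x) lies in ker τ, hence in ker τ', and τ' fixes τ(x). *)
Lemma retraction_kernel_uniq (k : fieldType) (Γ : groupType) (A : algType k)
    (G : gradedQHopf Γ A) (τ τ' : A -> neutral G) :
  neutral_retraction τ -> neutral_retraction τ' ->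
  (forall x, τ x = 0 -> τ' x = 0) -> τ = τ'.
Proof.
move=> rτ rτ' k0; apply/funext => x; apply/esym/eqP; rewrite -subr_eq0.
have := k0 (x - nval (τ x)).
rewrite (linear_fB (qm_linear rτ.1)) (linear_fB (qm_linear rτ'.1)) rτ.2 rτ'.2.
by rewrite subrr => ->.
Qed.

(** * From group-like units to a retraction and to the isomorphism with A_e ⊗ k[Γ] *)

Section GroupLikesSplitting.
Variables (k : fieldType) (Γ : groupType) (A : algType k).
Variable G : gradedQHopf Γ A.
Local Notation nv := (@nval _ _ _ G).
Variable u : Γ -> A.
Hypothesis cu : central_group_likes G u.

Let lv : linear nv := @nval_linear _ _ _ G.
Let mv : monoid_morphism nv := @nval_monoid _ _ _ G.
Let gu g : hcomp G g (u g). Proof. by case: cu. Qed.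
Let uM g h : u g * u h = u (g * h)%g. Proof. by case: cu. Qed.
Let uC g b : hcomp G 1%g b -> u g * b = b * u g.
Proof. by case: cu => _ _ _; apply. Qed.
Let cop_u g : cop G (u g) = u g ⊗ u g.
Proof. by case: cu => _ gl _ _; have [[]] := gl g. Qed.
Let eps_u g : eps G (u g) = 1.
Proof. by case: cu => _ gl _ _; have [[]] := gl g. Qed.

(** An idempotent unit is 1. *)
Lemma group_likes1 : u 1%g = 1.
Proof.
have [y [uy _]] : is_unit (u 1%g) by case: cu => _ gl _ _; have [] := gl 1%g.
by rewrite -uy -[in RHS](mulg1 1%g) -uM -mulrA uy mulr1.
Qed.

Lemma group_likesV g : u g * u g^-1%g = 1.
Proof. by rewrite uM mulgV group_likes1. Qed.

Lemma group_likesVg g : u g^-1%g * u g = 1.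
Proof. by rewrite uM mulVg group_likes1. Qed.

(** The antipode axiom at a group-like reads S(u)αu = α, and α commutes with u^-1. *)
Lemma antip_alpha_group_likes g :
  antip G (u g) * qalpha G = u g^-1%g * qalpha G.
Proof.
have := antip_alpha G (u g); rewrite cop_u eps_u scale1r.
rewrite (tliftE (mulSl_bilin (qalpha G) (antip_linear G))).
move=> E; rewrite (uC _ (hcomp_alpha G)) -[in RHS]E.
by rewrite -[RHS]mulrA group_likesV mulr1.
Qed.

(* S(u) = Σ S(u)S(φ1)αφ2βS(φ3) = Σ S(φ1)S(u)αφ2βS(φ3) for Φ^-1 = φ1⊗φ2⊗φ3,
   as u commutes with φ1; then S(u)α = u^-1 α, and u^-1 comes out in front. *)
Lemma antip_group_likes g : antip G (u g) = u g^-1%g.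
Proof.
have lm (x : A) : linear (fun y => x * y) by move=> a y z; rewrite mulrDr scalerAr.
rewrite -[LHS]mulr1 -[RHS]mulr1 -(zag_neutral G).
rewrite (tlift3_fun _ _ (lm (antip G (u g)))) (tlift3_fun _ _ (lm (u g^-1%g))).
apply: tlift3_ext => a b c; rewrite !mulrA -antipM -uC ?antipM; last exact: nval_hcomp.
rewrite -[in LHS](mulrA (antip G (nval a))) antip_alpha_group_likes.
by rewrite !mulrA -uC //; apply/antip_hcomp1/nval_hcomp.
Qed.

Lemma group_likes_scale g x : hcomp G g x ->
  nv (nproj G (x * u g^-1%g)) * u g = x.
Proof.
move=> gx; rewrite nprojK; last exact: hcompMV gx (gu _).
by rewrite -mulrA group_likesVg mulr1.
Qed.

Lemma nprojMu b g : nproj G (nv b * u g * u g^-1%g) = b.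
Proof. by rewrite -mulrA group_likesV mulr1 nvalK. Qed.

Lemma group_likes_ext (W : lmodType k) (f f' : A -> W) : linear f -> linear f' ->
  (forall b g, f (nv b * u g) = f' (nv b * u g)) -> f =1 f'.
Proof.
move=> lf lf' ff; apply: (@homogeneous_ext _ _ _ G) => // g x gx.
by rewrite -(group_likes_scale gx).
Qed.

Lemma nvalMu_hcomp (b : neutral G) g : hcomp G g (nv b * u g).
Proof. by apply: hcompM1l => //; exact: nval_hcomp. Qed.

Lemma nvalMuM (b c : neutral G) g h :
  nv b * u g * (nv c * u h) = nv (b * c) * u (g * h)%g.
Proof.
rewrite mulrA -[nv b * _ * _]mulrA uC; last exact: nval_hcomp.
by rewrite mv.2 -uM !mulrA.
Qed.

Lemma cop_nvalMu (b : neutral G) g :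
  cop G (nv b * u g) = tmap (fun x => nv x * u g) (fun x => nv x * u g) (ncop b).
Proof. by rewrite (tmap_pureMr _ _ lv) nval_cop (cop_monoid G).2 cop_u. Qed.

Lemma antip_nvalMu (b : neutral G) g :
  antip G (nv b * u g) = nv (nantip b) * u g^-1%g.
Proof.
rewrite antipM antip_group_likes uC ?nval_antip //.
exact/antip_hcomp1/nval_hcomp.
Qed.

Lemma eps_nvalMu (b : neutral G) g : eps G (nv b * u g) = neps b.
Proof. by rewrite (eps_monoid G).2 eps_u mulr1. Qed.

Definition group_likes_retraction : A -> neutral G :=
  hlift G (fun g y => nproj G (y * u g^-1%g)).
Local Notation τ := group_likes_retraction.

Let lφ g : linear (fun y => nproj G (y * u g^-1%g)).
Proof. by move=> a y z; rewrite mulrDl -scalerAl; exact: nproj_linear. Qed.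

Let lτ : linear τ. Proof. exact: (hlift_linear G lφ). Qed.

Lemma group_likes_retractionE b g : τ (nv b * u g) = b.
Proof. by rewrite /τ (hliftE lφ (nvalMu_hcomp b g)) nprojMu. Qed.

Lemma group_likes_retractionK b : τ (nv b) = b.
Proof. by rewrite -[nv b]mulr1 -group_likes1 group_likes_retractionE. Qed.

Lemma group_likes_retraction_u g : τ (u g) = 1.
Proof. by rewrite -[u g]mul1r -mv.1 group_likes_retractionE. Qed.

Let τ2K (t : (neutral G ⊗ neutral G)%type) : tmap τ τ (tmap nv nv t) = t.
Proof. by apply: (tmap_can lv lτ lv lτ); exact: group_likes_retractionK. Qed.

(** The products b u_g span A and τ sends them to b, so each compatibility is tested on them. Φ, α
    and β come from A_e, where τ is the identity. *)
Lemma group_likes_neutral_retraction : neutral_retraction τ.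
Proof.
have lt := tmap_linear lτ lτ.
split; last exact: group_likes_retractionK; split=> //.
- split; first by rewrite -mv.1 group_likes_retractionK.
  move=> x; apply: group_likes_ext => [a y z|a y z|c h].
  + by rewrite mulrDr -scalerAr lτ.
  + by rewrite lτ mulrDr -scalerAr.
  move: x; apply: group_likes_ext => [a y z|a y z|b g].
  + by rewrite mulrDl -scalerAl lτ.
  + by rewrite lτ mulrDl -scalerAl.
  by rewrite nvalMuM !group_likes_retractionE.
- apply: group_likes_ext => [||b g].
  + exact: linear_comp lτ (cop_linear (neutral_qHopf G)).
  + exact: linear_comp (cop_linear G) lt.
  + have lvu : linear (fun x => nv x * u g).
      by move=> a x y; rewrite lv mulrDl scalerAl.
    rewrite group_likes_retractionE cop_nvalMu.
    by rewrite (tmap_can lvu lτ lvu lτ) // => x; exact: group_likes_retractionE.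
- apply: (@group_likes_ext k^o) => [||b g].
  + exact: linear_comp lτ (eps_linear (neutral_qHopf G)).
  + exact: eps_linear.
  + by rewrite group_likes_retractionE eps_nvalMu.
- apply: group_likes_ext => [||b g].
  + exact: linear_comp lτ (antip_linear (neutral_qHopf G)).
  + exact: linear_comp (antip_linear G) lτ.
  + by rewrite antip_nvalMu !group_likes_retractionE.
- rewrite -nval_Phi; apply: (tmap_can lv lτ _ lt) => //.
    exact: tmap_linear lv lv.
  exact: group_likes_retractionK.
- by rewrite -nval_alpha group_likes_retractionK.
- by rewrite -nval_beta group_likes_retractionK.
Qed.

Definition group_likes_iso : (neutral G ⊗ gralg k Γ)%type -> A :=
  bglift (fun b g => nv b * u g).
Local Notation f := group_likes_iso.

Let lvu g : linear (fun b => nv b * u g).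
Proof. by move=> a x y; rewrite lv mulrDl scalerAl. Qed.

Lemma group_likes_isoE b g : f (b ⊗ 'ζ_g) = nv b * u g.
Proof. exact: (bgliftE lvu). Qed.

Let lf : linear f. Proof. exact: (bglift_linear lvu). Qed.

Lemma group_likes_iso_bij : bijective f.
Proof.
(* The inverse sends x in A_g to x u_g^-1 ⊗ ζ_g. *)
pose φ g (y : A) := nproj G (y * u g^-1%g) ⊗ ('ζ_g : gralg k Γ).
have lφ' g : linear (φ g) by move=> a x y; rewrite /φ lφ pureDl pureZl.
have lh := hlift_linear G lφ'.
exists (hlift G φ).
  apply: bg_ext => [||b g]; first exact: linear_comp lf lh.
    exact: linear_id.
  by rewrite group_likes_isoE (hliftE lφ' (nvalMu_hcomp b g)) /φ nprojMu.
apply: group_likes_ext => [||b g]; first exact: linear_comp lh lf.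
  exact: linear_id.
by rewrite (hliftE lφ' (nvalMu_hcomp b g)) /φ nprojMu group_likes_isoE.
Qed.

Lemma group_likes_graded_iso :
  graded_iso (group_tensor Γ (neutral_qHopf G)) G f.
Proof.
split; last exact: group_likes_iso_bij.
split; last by move=> g _ [b ->]; rewrite group_likes_isoE; exact: nvalMu_hcomp.
have lb g := @bgin_linear k Γ (neutral G) g.
have f1 b : f (bgin 1%g b) = nv b by rewrite group_likes_isoE group_likes1 mulr1.
pose T := group_tensor Γ (neutral_qHopf G).
split=> //.
- split; first by rewrite bg1E group_likes_isoE group_likes1 mulr1.
  apply: bg_mulext; first exact: bilin_post (mul_bilin _) lf.
    exact: bilin_comp lf lf (mul_bilin A).
  by move=> x g y h; rewrite pureM gbasisM !group_likes_isoE nvalMuM.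
- apply: bg_ext => [||b g].
  + exact: linear_comp lf (cop_linear G).
  + exact: linear_comp (cop_linear T) (tmap_linear lf lf).
  + rewrite group_likes_isoE cop_nvalMu [cop _ _]bgcopE (tmap_comp _ (lb g) lf (lb g) lf).
    by apply: tmap_ext => x; rewrite group_likes_isoE.
- apply: (@bg_ext _ _ _ k^o) => [||b g].
  + exact: linear_comp lf (eps_linear G).
  + exact: (eps_linear T).
  + by rewrite group_likes_isoE eps_nvalMu [RHS]bgepsE.
- apply: bg_ext => [||b g].
  + exact: linear_comp lf (antip_linear G).
  + exact: linear_comp (antip_linear T) lf.
  + by rewrite group_likes_isoE antip_nvalMu [antip _ _]bgantipE group_likes_isoE.
- have l1 := lb 1%g; rewrite -(nval_Phi G).
  rewrite [LHS](tmap_comp _ l1 lf (tmap_linear l1 l1) (tmap_linear lf lf)).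
  apply: tmap_ext => // t; rewrite (tmap_comp _ l1 lf l1 lf).
  exact: tmap_ext.
- by rewrite -(nval_alpha G) -f1.
- by rewrite -(nval_beta G) -f1.
Qed.

End GroupLikesSplitting.

(** * From an augmented complement to a retraction *)

Lemma tens_sub_tlift (k : fieldType) (U V W : lmodType k) (f : U -> V -> W)
    (P : set U) (Q : set V) (R : set W) (t : (U ⊗ V)%type) :
  bilin f -> subspace R -> (forall u v, P u -> Q v -> R (f u v)) ->
  tens_sub P Q t -> R (tlift f t).
Proof.
move=> bf sR fR; have lf := tlift_is_linear bf.
apply: (tens_sub_ind (R := fun t => R (tlift f t))) => [|s s' Hs Hs'|u v Pu Qv].
- by rewrite (linear_f0 lf); exact: sR.1.
- by rewrite (linear_fD lf); exact: subspaceD.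
- by rewrite (tliftE bf); exact: fR.
Qed.

(** By counitality, ε(φ(x')x'') = φ(x' ε(x'')) = φ(x). *)
Lemma eps_contract (k : fieldType) (A : algType k) (H : quasiHopf A)
    (φ : A -> k^o) x : linear φ ->
  eps H (tlift (fun a b => φ a *: b) (cop H x)) = φ x.
Proof.
move=> lφ; rewrite -[x in RHS](counit_r H) (tlift_fun _ _ lφ).
rewrite (tlift_fun _ _ (eps_linear H)); apply: tlift_ext => a b.
by rewrite (linear_fZ (eps_linear H)) (linear_fZ lφ) /= [LHS]mulrC.
Qed.

Section AugmentedComplement.
Variables (k : fieldType) (Γ : groupType) (A : algType k).
Variable G : gradedQHopf Γ A.
Local Notation nv := (@nval _ _ _ G).
Variable L : set A.
Hypothesis iL : qHopf_ideal G L.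

Lemma qHopf_ideal_subspace : subspace L.
Proof. by split; [exact: qi_0 iL | exact: qi_linear iL]. Qed.
Let sL := qHopf_ideal_subspace.

Lemma contract_ideal (f : A -> A -> A) x : bilin f ->
  (forall a b, L a -> L (f a b)) -> (forall a b, L b -> L (f a b)) ->
  L x -> L (tlift f (cop G x)).
Proof.
move=> bf fl fr /(qi_cop iL)[s [t [Ls Lt ->]]].
rewrite (linear_fD (tlift_is_linear bf)); apply: (subspaceD sL).
  by apply: (tens_sub_tlift bf sL _ Ls) => u v Lu _; exact: fl.
by apply: (tens_sub_tlift bf sL _ Lt) => u v _ Lv; exact: fr.
Qed.

(** Both legs of Δ(A_h) lie in A_h and [f] keeps the degree of its second argument, so the
    contraction is a graded map. *)
Lemma hproj_contract (f : A -> A -> A) g x : bilin f ->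
  (forall h a b, hcomp G h b -> hcomp G h (f a b)) ->
  hproj G g (tlift f (cop G x)) = tlift f (cop G (hproj G g x)).
Proof.
move=> bf fP.
apply: (@hproj_graded _ _ _ _ (fun x => tlift f (cop G x))).
  exact: linear_comp (cop_linear G) (tlift_is_linear bf).
move=> h y hy; apply: (tens_sub_tlift bf (hcomp_subspace G h) _ (hcomp_cop hy)).
by move=> a b _; exact: fP.
Qed.

Hypothesis L_neutral0 : forall x, hcomp G 1%g x -> L x -> x = 0.

(* Contracting Δ(l) against a functional, resp. against S(-)α, stays in L and
   does not enlarge the support; for this the first tensor factor is sent to
   A_e by a linear retraction killing L. *)
Lemma normalize_neutral l : L l -> hproj G 1%g l <> 0 ->
  exists y, [/\ L y, hproj G 1%g y = 1 &
    forall h, hproj G h l = 0 -> hproj G h y = 0].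
Proof.
move=> Ll /eqP/exists_linear_form[φ lφ φl].
have [r [lr rP rK rL]] :=
  exists_linear_retraction (hcomp_subspace G 1%g) sL L_neutral0.
have lφr := linear_comp lr lφ; have lSr := linear_comp lr (antip_linear G).
pose f0 a (b : A) : A := φ (r a) *: b; pose f1 a b := antip G (r a) * qalpha G * b.
have b0 : bilin f0 := scale_bilinl lφr.
have b1 : bilin f1 := mulSl_bilin (qalpha G) lSr.
have g0 h a b : hcomp G h b -> hcomp G h (f0 a b) by move=> hb; exact: hcompZ.
have g1 h a b : hcomp G h b -> hcomp G h (f1 a b).
  move=> hb; rewrite /f1 -mulrA; apply: hcompM1l; first exact/antip_hcomp1/rP.
  by apply: hcompM1l => //; exact: hcomp_alpha.
pose m0 := tlift f0 (cop G l); pose m := tlift f1 (cop G m0).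
have Lm0 : L m0.
  apply: contract_ideal Ll => // a b; last exact: (subspaceZ sL).
  by move=> La; rewrite /f0 rL // (linear_f0 lφ) scale0r; exact: sL.1.
have Lm : L m.
  apply: contract_ideal Lm0 => // a b; last exact: (qi_mull iL).
  by move=> La; rewrite /f1 rL // (linear_f0 (antip_linear G)) !mul0r; exact: sL.1.
have mS h : hproj G h l = 0 -> hproj G h m = 0.
  move=> l0; rewrite !hproj_contract // l0 !(linear_f0 (cop_linear G)).
  by rewrite (linear_f0 (tlift_is_linear b0)) !(linear_f0 (cop_linear G))
    (linear_f0 (tlift_is_linear b1)).
(* The neutral component b of [m0] has ε(b) = φ(l_e) = 1. As [r] fixes A_e, that of [m] is S(b')αb''
   = ε(b)α. *)
have mα : hproj G 1%g m = qalpha G.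
  rewrite hproj_contract //; set b := hproj G 1%g m0.
  have eb : eps G b = 1.
    by rewrite /b hproj_contract // (eps_contract G _ lφr) rK ?φl //; exact: hproj_mem.
  have lv := @nval_linear _ _ _ G.
  rewrite -[RHS]scale1r -eb -antip_alpha [b](_ : _ = nv (nproj G m0)) // -nval_cop.
  rewrite (tlift_tmap _ lv lv b1).
  rewrite (tlift_tmap _ lv lv (mulSl_bilin (qalpha G) (antip_linear G))).
  by apply: tlift_ext => c d; rewrite /f1 rK //; exact: nval_hcomp.
(* The neutral components of elements of L supported where l is are closed under sums and, through a
   m c, include every aαc with a, c in A_e. *)
apply: (@ideal_alpha1 _ _ _ G (fun b => exists y, [/\ L y, hproj G 1%g y = b &
    forall h, hproj G h l = 0 -> hproj G h y = 0])).
- exists 0; split=> [||h _]; first exact: sL.1.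
    exact: linear_f0 (hproj_linear G _).
  exact: linear_f0 (hproj_linear G _).
- move=> x y [x' [Lx <- Sx]] [y' [Ly <- Sy]]; exists (x' + y'); split=> [||h h0].
  + exact: subspaceD.
  + exact: linear_fD (hproj_linear G _) _ _.
  + by rewrite (linear_fD (hproj_linear G _)) Sx // Sy // addr0.
- move=> a c ha hc; exists (a * m * c).
  have E h : hproj G h (a * m * c) = a * hproj G h m * c.
    by rewrite -{1}[h]mulg1 (hproj_mulr _ _ hc) hproj_mull.
  split=> [||h /mS h0].
  + exact/(qi_mulr iL)/(qi_mull iL).
  + by rewrite E mα.
  + by rewrite E h0 mulr0 mul0r.
Qed.

(* For t in [meeting], A_t and A_e have the same image in A/L. *)
Definition meeting (t : Γ) : Prop := exists2 u, hcomp G t u & L (1 - u).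

Lemma meeting1 : meeting 1%g.
Proof. by exists 1; [exact: hcomp1 | rewrite subrr; exact: sL.1]. Qed.

Lemma meetingM s t : meeting s -> meeting t -> meeting (s * t)%g.
Proof.
move=> [u su Lu] [v tv Lv]; exists (u * v); first exact: hcompM.
have -> : 1 - u * v = (1 - u) + u * (1 - v) by rewrite mulrBr mulr1 addrA subrK.
by apply: (subspaceD sL) => //; exact: (qi_mull iL).
Qed.

(** The antipode inverts degrees, fixes 1 and preserves L. *)
Lemma meetingV t : meeting t -> meeting t^-1%g.
Proof.
move=> [u tu Lu]; exists (antip G u); first exact: hcomp_antip.
rewrite -(antip1 G) -(linear_fB (antip_linear G)); exact: (qi_antip iL).
Qed.

Lemma meetingMl t h : meeting t -> meeting (t * h)%g = meeting h.
Proof.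
move=> mt; apply/propext; split; last exact: meetingM.
by move=> /(meetingM (meetingV mt)); rewrite mulKg.
Qed.

Hypothesis G_faithful : faithfully_graded G.

(** If x ≠ 0, some a in A_(g^-1) has xa ≠ 0, yet xa lies in L ∩ A_e. *)
Lemma homogeneous_L0 g x : hcomp G g x -> L x -> x = 0.
Proof.
move=> gx Lx; apply: contrapT => /(homogeneous_regular G_faithful g^-1%g)[a ga].
by apply; apply: L_neutral0 (hcompMV gx ga) _; exact: (qi_mulr iL).
Qed.

(* With y = 1 + Σ y_h in L, h ≠ e, each φ vanishing on L yields an element
   φ(y')y'' - φ(1)y of L of smaller support. If these all vanish then
   φ(y_h) = φ(1)ε(y_h) for all φ, so that y_h = ε(y_h)1 modulo L. *)
Lemma meeting_pair n (d : seq Γ) l : (size d <= n)%N -> L l -> l <> 0 ->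
  (forall h, h \notin d -> hproj G h l = 0) ->
  exists h h', [/\ h \in d, h' \in d, h != h' & meeting (h' * h^-1)%g].
Proof.
elim: n d l => [|n IH] [|h d] l //= sd Ll l0 supp;
  try by case: l0; apply: hproj_eq0 => g; exact: supp.
(* Whenever [d] alone contains the support, induction applies at once; so h may be assumed in the
   support and absent from [d]. *)
have IHd : (forall g, g \notin d -> hproj G g l = 0) ->
    exists i j, [/\ i \in h :: d, j \in h :: d, i != j & meeting (j * i^-1)%g].
  move=> supp'; have [i [j [di dj ij m]]] := IH d l sd Ll l0 supp'.
  by exists i, j; split=> //; rewrite inE ?di ?dj orbT.
have [lh0|/eqP lh0] := eqVneq (hproj G h l) 0.
  by apply: IHd => g gd; have [->//|gh] := eqVneq g h; apply: supp; rewrite inE negb_or gh.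
have [hd|hd] := boolP (h \in d).
  apply: IHd => g gd; apply: supp; rewrite inE negb_or gd andbT.
  by apply: contraNneq gd => ->.
(* Right multiplication by [a] carries the component at h to degree e and the remaining support into
   [D]. *)
have [a ga la] := homogeneous_regular G_faithful h^-1%g lh0.
have pl g : hproj G g (l * a) = hproj G (g * h)%g l * a.
  by rewrite -{1}[g](mulgK h) (hproj_mulr _ _ ga).
pose D := [seq (g * h^-1)%g | g <- d].
have [|y [Ly y1 Sy]] := normalize_neutral (qi_mulr iL a Ll).
  by rewrite pl mul1g.
have suppy g : g != 1%g -> g \notin D -> hproj G g y = 0.
  move=> g1 gD; apply: Sy; rewrite pl supp ?mul0r // inE negb_or.
  rewrite -[X in _ == X]mul1g (inj_eq (mulIg h)) g1 /=.
  by apply: contra gD => ghd; apply/mapP; exists (g * h)%g; rewrite ?mulgK.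
pose Θ (φ : A -> k^o) x := tlift (fun a b => φ a *: b) (cop G x).
have ΘP φ x g : linear φ -> hproj G g (Θ φ x) = Θ φ (hproj G g x).
  move=> lφ; apply: hproj_contract; first exact: scale_bilinl.
  by move=> *; exact: hcompZ.
have Θ1 φ : linear φ -> Θ φ 1 = φ 1 *: 1.
  by move=> lφ; rewrite /Θ (cop_monoid G).1 tens1E (tliftE (scale_bilinl lφ)).
(* If some φ killing L makes φ(y')y'' - φ(1)y nonzero, induction applies to this element: its
   neutral component cancels, so [D] contains its support. The factor h^-1 drops out of the quotient
   of the two degrees found. *)
have [[φ [lφ φL z0]]|noφ] := pselect (exists φ : A -> k^o, [/\ linear φ,
    forall x, L x -> φ x = 0 & Θ φ y - φ 1 *: y <> 0]).
  have [|||_ [_ [/mapP[g gd ->] /mapP[g' g'd ->] gg' m]]] := IH D _ _ _ z0.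
  - by rewrite size_map.
  - apply: (subspaceB sL); last exact: (subspaceZ sL).
    apply: contract_ideal Ly => [|b c Lb|b c Lc]; first exact: scale_bilinl.
      by rewrite φL // scale0r; exact: sL.1.
    exact: (subspaceZ sL).
  - move=> g gD; rewrite (linear_fB (hproj_linear G g)) (linear_fZ (hproj_linear G g)).
    rewrite ΘP //; have [->|g1] := eqVneq g 1%g; first by rewrite y1 Θ1 // subrr.
    by rewrite suppy // scaler0 subr0 /Θ (linear_f0 (cop_linear G))
      (linear_f0 (tlift_is_linear (scale_bilinl lφ))).
  exists g, g'; split; rewrite ?inE ?gd ?g'd ?orbT //.
    by apply: contraNneq gg' => ->.
  by move: m; rewrite invgM invgK mulgA mulgVK.
(* Otherwise y = 1 would lie in L ∩ A_e. *)
have [g [g1 yg]] : exists g, g != 1%g /\ hproj G g y <> 0.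
  apply: contrapT => no; have /eqP := oner_neq0 A; apply.
  apply: (L_neutral0 (hcomp1 G)); have -> // : 1 = y.
  apply/eqP; rewrite -subr_eq0; apply/eqP/(@hproj_eq0 _ _ _ G) => g.
  rewrite (linear_fB (hproj_linear G g)) (hprojE _ (hcomp1 G)).
  have [<-|g1] := eqVneq 1%g g; first by rewrite y1 subrr.
  rewrite sub0r; have [->|/eqP yg] := eqVneq (hproj G g y) 0; first exact: oppr0.
  by case: no; exists g; rewrite eq_sym.
have gD : g \in D by apply: contrapT => /negP gD; apply: yg; exact: suppy.
have Lc : L (hproj G g y - eps G (hproj G g y) *: 1).
  (* A form killing L with value 1 here contradicts φ(y_g) = φ(1)ε(y_g), which results from applying
     ε to the component at g of φ(y')y'' - φ(1)y = 0. *)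
  apply: contrapT => /(separating_form sL)[φ [lφ φ1 φL]].
  have z0 : Θ φ y - φ 1 *: y = 0 by apply: contrapT => z0; apply: noφ; exists φ.
  have := congr1 (fun x => eps G (hproj G g x)) z0.
  rewrite (linear_fB (hproj_linear G g)) (linear_fZ (hproj_linear G g)) ΘP //.
  rewrite (linear_fB (eps_linear G)) (linear_fZ (eps_linear G)) eps_contract //.
  rewrite (linear_f0 (hproj_linear G g)) (linear_f0 (eps_linear G)) => E.
  move: φ1; rewrite (linear_fB lφ) (linear_fZ lφ).
  rewrite [_ *: _](mulrC _ (φ 1) : _ = φ 1 *: (eps G _ : k^o)) E.
  by move/esym/eqP; rewrite oner_eq0.
have /eqP c0 : eps G (hproj G g y) <> 0.
  move=> c0; apply: yg; apply: homogeneous_L0 (hproj_mem G g y) _.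
  by move: Lc; rewrite c0 scale0r subr0.
have /mapP[h' h'd gE] := gD.
exists h, h'; split; rewrite ?inE ?eqxx ?h'd ?orbT //.
  by apply: contraNneq hd => ->.
(* Dividing y_g by ε(y_g) gives an element of A_g congruent to 1 modulo L. *)
rewrite -gE; exists ((eps G (hproj G g y))^-1 *: hproj G g y).
  exact/hcompZ/hproj_mem.
move: (subspaceN sL (subspaceZ sL (eps G (hproj G g y))^-1 Lc)).
by rewrite scalerBr scalerA mulVf // scale1r opprB.
Qed.

Definition meeting_form : gralg k Γ -> k^o := glift (fun h => `[< meeting h >]%:R : k^o).

Let lm : linear meeting_form := glift_linear _.

(* Moving a component along [meeting] keeps the value of the form and shrinks
   the support. *)
Lemma meeting_form0 l : L l -> meeting_form (grading_map G l) = 0.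
Proof.
have lν : linear (fun x => meeting_form (grading_map G x)).
  exact: linear_comp (grading_map_linear G) lm.
have νE g x : hcomp G g x ->
    meeting_form (grading_map G x) = eps G x * `[< meeting g >]%:R.
  by move=> gx; rewrite (grading_mapE gx) (linear_fZ lm) [meeting_form _]gliftE.
have [d supp] : exists d : seq Γ, forall h, h \notin d -> hproj G h l = 0.
  by exists (enum_fset (msupp (hdecomp G l))) => h; exact: mcoeff_outdom.
have [n] := ubnP (size d); elim: n d l supp => // n IH d l supp sd Ll.
have [->|/eqP l0] := eqVneq l 0; first exact: (linear_f0 lν).
have [h [h' [hd h'd hh' [u tu Lu]]]] := meeting_pair (leqnn (size d)) Ll l0 supp.
pose x := hproj G h l; have hx : hcomp G h x := hproj_mem G h l.
have hux : hcomp G h' (u * x) by rewrite -[h'](mulgVK h); exact: hcompM.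
have Lx : L ((1 - u) * x) by exact: (qi_mulr iL).
have eu : eps G u = 1.
  apply/esym/eqP; rewrite -subr_eq0 -{1}(eps_monoid G).1.
  by rewrite -(linear_fB (eps_linear G)) (qi_eps iL Lu).
(* x and ux have the same counit, and their degrees h and h'h^-1 h are both in [meeting] or both
   outside it. *)
have νx : meeting_form (grading_map G ((1 - u) * x)) = 0.
  rewrite mulrBl mul1r (linear_fB lν) (νE _ _ hx) (νE _ _ hux).
  rewrite (eps_monoid G).2 eu mul1r -[h' in X in _ - X](mulgVK h).
  by rewrite meetingMl ?subrr //; exists u.
rewrite -[l](subrK ((1 - u) * x)) (linear_fD lν) νx addr0.
(* Subtracting (1 - u)x replaces the component x at h by ux at h', which is already in [d]; so h
   leaves the support. *)
apply: (IH [seq g <- d | g != h]); last exact: (subspaceB sL).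
  move=> g; rewrite mem_filter negb_and negbK.
  rewrite mulrBl mul1r !(linear_fB (hproj_linear G g)) (hprojE _ hx) (hprojE _ hux).
  have [->|gh /= gd] := eqVneq g h.
    by rewrite [h' == h]eq_sym (negPf hh') mulr1n mulr0n subr0 subrr.
  rewrite (supp _ gd) mulr0n !sub0r opprK.
  by case: eqP => // gE; rewrite -gE h'd in gd.
rewrite size_filter; apply: leq_trans (sd : (_ <= n)%N).
rewrite -(count_predC (pred1 h) d) -addn1 addnC leq_add2r.
by rewrite -has_count has_pred1.
Qed.

Hypothesis aL : augmented G L.

(** Augmentation puts ζ_g - ζ_e in π(L), where the form vanishes; its value there is the indicator
    at g minus 1. *)
Lemma meeting_all g : meeting g.
Proof.
have [l Ll lE] : exists2 l, L l & grading_map G l = 'ζ_g - 'ζ_(1%g).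
  have : @augmentation_ideal k Γ ('ζ_g - 'ζ_(1%g)).
    by exists [:: (1, g)]; rewrite big_seq1 scale1r.
  by rewrite -aL.
have := meeting_form0 Ll; rewrite lE (linear_fB lm) /meeting_form !gliftE.
rewrite (asboolT meeting1); case: asboolP => // _ /eqP.
by rewrite sub0r oppr_eq0 oner_eq0.
Qed.

Lemma neutral_mod_L x : exists b : neutral G, L (x - nv b).
Proof.
rewrite (hsum_hproj G x).
apply: (@subspace_sum _ _ [set x | exists b : neutral G, L (x - nv b)]%classic).
  split=> [|a y z [b Lb] [c Lc]]; first by exists 0; rewrite subr0; exact: sL.1.
  by exists (a *: b + c); rewrite opprD addrACA -scalerBr; exact: sL.2.
(* With u in A_(g^-1) congruent to 1, the component x_g is congruent to x_g u, which has degree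
   e. *)
move=> g; have [u gu Lu] := meeting_all g^-1%g; have gx := hproj_mem G g x.
exists (nproj G (hproj G g x * u)); rewrite nprojK; last exact: hcompMV gu.
by rewrite -[X in X - _]mulr1 -mulrBr; exact: (qi_mull iL).
Qed.

Lemma neutral_mod_L_uniq x (b c : neutral G) : L (x - nv b) -> L (x - nv c) -> b = c.
Proof.
move=> Lb Lc; apply: nval_inj; apply/eqP; rewrite -subr_eq0; apply/eqP/L_neutral0.
  by apply: (subspaceB (hcomp_subspace G _)); exact: nval_hcomp.
by have := subspaceB sL Lc Lb; rewrite opprB addrC addrA subrK.
Qed.

(** τ(x) is the unique element of A_e congruent to x modulo L; uniqueness turns congruences modulo L
    into equalities. *)
Lemma exists_retraction_kernel :
  exists2 τ : A -> neutral G, neutral_retraction τ & forall x, τ x = 0 <-> L x.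
Proof.
pose τ x := sval (cid (neutral_mod_L x)).
have τP x : L (x - nv (τ x)) by rewrite /τ; case: cid.
have τU x b : L (x - nv b) -> τ x = b by exact: neutral_mod_L_uniq.
have τ0 x : L x -> τ x = 0 by move=> Lx; apply: τU; rewrite subr0.
have τv b : τ (nv b) = b by apply: τU; rewrite subrr; exact: sL.1.
have lv := @nval_linear _ _ _ G.
have lτ : linear τ.
  move=> a x y; apply: τU; rewrite opprD addrACA -scalerBr; exact: sL.2.
have lt := tmap_linear lτ lτ.
exists τ; last first.
  by move=> x; split=> [x0|/τ0//]; have := τP x; rewrite x0 subr0.
split; last exact: τv; split=> //.
- split=> [|x y]; first exact: (τv 1).
  apply: τU; have -> : x * y - nv (τ x * τ y) =
    (x - nv (τ x)) * y + nv (τ x) * (y - nv (τ y)).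
    by rewrite mulrBl mulrBr addrA subrK.
  by apply: (subspaceD sL); [exact: (qi_mulr iL) | exact: (qi_mull iL)].
(* Split x as (x - τ(x)) + τ(x): the first summand is in L, and τ⊗τ kills L⊗A + A⊗L. *)
- move=> x; rewrite -[x in RHS](subrK (nv (τ x))).
  rewrite (linear_fD (cop_linear G)) (linear_fD lt) -nval_cop.
  rewrite (tmap_can lv lτ lv lτ τv τv) [X in X + _](_ : _ = 0) ?add0r //.
  have [s [t [Ls Lt ->]]] := qi_cop iL (τP x).
  have s0 : subspace [set t : (neutral G ⊗ neutral G)%type | t = 0]%classic.
    by split=> // a y z -> ->; rewrite scaler0 addr0.
  rewrite (linear_fD lt).
  rewrite [X in X + _](tens_sub_tlift (tmap_bilin lτ lτ) s0 _ Ls) ?add0r => [|a b La _].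
    apply: (tens_sub_tlift (tmap_bilin lτ lτ) s0 _ Lt) => a b _ Lb /=.
    by rewrite (τ0 b) // pure0r.
  by rewrite /= (τ0 a) // pure0l.
- move=> x; have := qi_eps iL (τP x).
  by rewrite (linear_fB (eps_linear G)) => /eqP; rewrite subr_eq0 => /eqP.
- move=> x; apply/esym/τU; rewrite nval_antip -(linear_fB (antip_linear G)).
  exact: (qi_antip iL).
- rewrite -(nval_Phi G); apply: (tmap_can lv lτ _ lt τv) => //.
    exact: (tmap_linear lv lv).
  exact: (tmap_can lv lτ lv lτ τv τv).
- by rewrite -(nval_alpha G) τv.
- by rewrite -(nval_beta G) τv.
Qed.

End AugmentedComplement.

(** * The equivalence, mutual determination and the isomorphism *)

Theorem theorem5p19 (k : fieldType) (Γ : groupType) (A : algType k)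
    (G : gradedQHopf Γ A) (G_faithful : faithfully_graded G) :
  [/\ [<-> exists τ : A -> neutral G, neutral_retraction τ;
           exists L : set A, augmented_complement G L;
           exists u : Γ -> A, central_group_likes G u],
      forall τ : A -> neutral G, neutral_retraction τ ->
        exists! Lu : set A * (Γ -> A),
          [/\ augmented_complement G Lu.1, central_group_likes G Lu.2
            & splitting_linked τ Lu.1 Lu.2],
      forall L : set A, augmented_complement G L ->
        exists! τu : (A -> neutral G) * (Γ -> A),
          [/\ neutral_retraction τu.1, central_group_likes G τu.2
            & splitting_linked τu.1 L τu.2],
      forall u : Γ -> A, central_group_likes G u ->
        exists! τL : (A -> neutral G) * set A,
          [/\ neutral_retraction τL.1, augmented_complement G τL.2
            & splitting_linked τL.1 τL.2 u]
    & forall u : Γ -> A, central_group_likes G u ->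
        exists f : (neutral G ⊗ gralg k Γ)%type -> A,
          graded_iso (group_tensor Γ (neutral_qHopf G)) G f /\
          forall (b : neutral G) (g : Γ), f (b ⊗ 'ζ_g) = nval b * u g ].
Proof.
have retraction_of_L L : augmented_complement G L -> exists2 τ : A -> neutral G,
    neutral_retraction τ & L = [set x | τ x = 0]%classic.
  move=> [iL aL L0]; have L_neutral0 x : hcomp G 1%g x -> L x -> x = 0.
    by move=> ex Lx; have : (L `&` hcomp G 1%g)%classic x by []; rewrite L0.
  have [τ rτ τL] := exists_retraction_kernel iL L_neutral0 G_faithful aL.
  by exists τ => //; apply/seteqP; split=> x /τL.
split.
- split; [|split].
  + by move=> [τ rτ]; eexists; exact: kernel_augmented_complement rτ G_faithful.
  + move=> [L /retraction_of_L[τ rτ _]].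
    have [u cu _] := retraction_central_group_likes rτ G_faithful.
    by exists u.
  + move=> [u /group_likes_neutral_retraction rτ]; eexists; exact: rτ.
- move=> τ rτ; have [u cu u1] := retraction_central_group_likes rτ G_faithful.
  exists ([set x | τ x = 0]%classic, u); split.
    by split=> //; exact: kernel_augmented_complement.
  move=> [L' u'] [/= _ cu' [-> u1']]; congr pair.
  exact: (retraction_group_likes_uniq rτ).
- move=> L /[dup] aL /retraction_of_L[τ rτ LE].
  have [u cu u1] := retraction_central_group_likes rτ G_faithful.
  exists (τ, u); split; first by [].
  move=> [τ' u'] [/= rτ' cu' [LE' u1']].
  (* Both kernels equal L, and a retraction is determined by its kernel. *)
  have ττ' : τ = τ'.
    apply: (retraction_kernel_uniq rτ rτ') => x x0.
    by have : L x; [rewrite LE | rewrite LE'].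
  rewrite -ττ' in u1' *; congr pair.
  exact: (retraction_group_likes_uniq rτ).
- move=> u cu; have rτ := group_likes_neutral_retraction cu.
  have u1 := group_likes_retraction_u cu.
  exists (group_likes_retraction G u, [set x | group_likes_retraction G u x = 0]%classic).
  split; first by split=> //; exact: kernel_augmented_complement.
  move=> [τ' L'] [/= rτ' aL' [-> u1']].
  (* Any retraction sending each u_g to 1 is given on A_g by x u_g^-1. *)
  have <- // : group_likes_retraction G u = τ'.
  by apply/funext => x; rewrite (retraction_group_likesE rτ' x cu u1').
- move=> u cu; exists (group_likes_iso u); split; first exact: group_likes_graded_iso.
  exact: group_likes_isoE.
Qed.
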